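(* Let $G/H$ be a para-Hermitian symmetric space with $G$ simple, let $\lambda\in\mathbb C$, and let $\widetilde R_\lambda$ be the representation of $\widetilde G=G\times G$ described in the context, realized in functions on $\mathcal X\cong G/H$. Then in horospherical coordinates $(\xi,\eta)\in\mathfrak q^-\times\mathfrak q^+$ on $G/H$ the representation $\widetilde R_\lambda$ is given, for all $g_1,g_2\in G$, by $$ \big(\widetilde R_\lambda(g_1,g_2)f\big)(\xi,\eta)=\frac{\Phi_\lambda(\xi\bullet g_2,\ \eta\circ g_1)}{\Phi_\lambda(\xi,\eta)}\ \omega_\lambda(\widetilde h_2)\ \omega_\lambda(\widehat h_1^{-1})\ f(\xi\bullet g_2,\ \eta\circ g_1), $$ where $\xi\bullet g_2\in\mathfrak q^-$ and $\widetilde h_2\in H$ are determined by the decomposition $\exp\xi\cdot g_2=\exp Y_2\cdot\widetilde h_2\cdot\exp(\xi\bullet g_2)$ with $Y_2\in\mathfrak q^+$, and $\eta\circ g_1\in\mathfrak q^+$ and $\widehat h_1\in H$ are determined by the decomposition $\exp\eta\cdot g_1=\exp X_1\cdot\widehat h_1\cdot\exp(\eta\circ g_1)$ with $X_1\in\mathfrak q^-$. The identity is understood at all $(\xi,\eta)$ for which the decompositions involved exist (an open dense set depending on $g_1,g_2$).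
   Context: **The space.** $G$ is a connected simple real Lie group with Lie algebra $\mathfrak g$, $\sigma\neq 1$ is an involutive automorphism of $G$, and $H$ (Lie algebra $\mathfrak h$) is an open subgroup of the fixed point subgroup $G^\sigma$. Let $\mathfrak g=\mathfrak h+\mathfrak q$ be the decomposition into $\pm1$-eigenspaces of $\sigma$. Groups act on homogeneous spaces from the right, so $G/H$ consists of the cosets $Hg$. The space $G/H$ is para-Hermitian: it is the adjoint orbit of an element $Z_0\in\mathfrak g$ with stabilizer $H$, the center of $\mathfrak h$ is $Z(\mathfrak h)=\mathbb R Z_0$, and $Z_0$ is normalized so that $\mathrm{ad}\,Z_0$ restricted to $\mathfrak q$ is diagonalizable with eigenvalues $\pm1$. Let $\mathfrak q^\pm\subset\mathfrak q$ be the $\pm1$-eigenspaces; they are Abelian subalgebras and $\mathfrak g=\mathfrak q^-+\mathfrak h+\mathfrak q^+$ is a graded Lie algebra. Put $Q^\pm=\exp\mathfrak q^\pm$. The subgroups $P^\pm=HQ^\pm=Q^\pm H$ are maximal parabolic subgroups with $P^+\cap P^-=H$, and $Q^+HQ^-$ and $Q^-HQ^+$ are open and dense in $G$. Almost every $g\in G$ can be written uniquely as $\exp\eta\cdot h\cdot\exp\xi$, and uniquely as $\exp\xi\cdot h\cdot\exp\eta$, with $\xi\in\mathfrak q^-$, $\eta\in\mathfrak q^+$, $h\in H$ (different triples in the two cases). **Actions on $\mathfrak q^\mp$.** For $g\in G$, $\xi\in\mathfrak q^-$, $\eta\in\mathfrak q^+$, the elements $\xi\bullet g\in\mathfrak q^-$,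 $\eta\circ g\in\mathfrak q^+$ and $\widetilde h,\widehat h\in H$ are defined by $$\exp\xi\cdot g=\exp Y\cdot\widetilde h\cdot\exp(\xi\bullet g),\qquad \exp\eta\cdot g=\exp X\cdot\widehat h\cdot\exp(\eta\circ g),\qquad X\in\mathfrak q^-,\ Y\in\mathfrak q^+,$$ whenever these decompositions exist. **Horospherical coordinates.** For $(\xi,\eta)\in\mathfrak q^-\times\mathfrak q^+$ (in an open dense set) write $$\exp\xi\cdot\exp(-\eta)=\exp(-Y)\cdot\exp X\cdot h,\qquad X\in\mathfrak q^-,\ Y\in\mathfrak q^+,\ h\in H,$$ and denote $h=h(\xi,\eta)$. Put $s=\exp Y\cdot\exp\xi=\exp X\cdot h(\xi,\eta)\cdot\exp\eta$. The pair $(\xi,\eta)$ is then the pair of horospherical coordinates of the point $Hs\in G/H$. These are coordinates on an open dense subset of $G/H$. **The character and $\Phi_\lambda$.** For $h\in H$ let $b(h)=\det\big(\mathrm{Ad}\,h|_{\mathfrak q^+}\big)$. Let $\varkappa$ be the genus of the Jordan pair $(\mathfrak q^+,\mathfrak q^-)$ with product $\{XYZ\}=\frac12[[X,Y],Z]$. One has $b(h(\xi,\eta))=N(\xi,\eta)^{-\varkappa}$, where $N(\xi,\eta)$ is an irreducible polynomial, of degree $r$ (the rank of the Jordan pair) in $\xi$ and in $\eta$ separately. For $\lambda\in\mathbb C$ set $$\omega_\lambda(h)=|b(h)|^{-\lambda/\varkappa}\quad(h\in H),\qquad \Phi_\lambda(\xi,\eta)=|N(\xi,\eta)|^\lambda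 ,$$ so that $\omega_\lambda(h(\xi,\eta))=\Phi_\lambda(\xi,\eta)$. **The representation $\widetilde R_\lambda$.** Let $\mathcal C$ be the manifold of all subsets (''double cosets'') $y=s_1^{-1}Q^-Q^+s_2$ of $G$, $s_1,s_2\in G$. The group $\widetilde G=G\times G$ acts on $\mathcal C$ by $y\mapsto g_1^{-1}yg_2$. Let $\mathcal D_\lambda(\mathcal C)$ be the space of $C^\infty$ functions $f$ on $\mathcal C$ with $$f(s_1^{-1}hQ^-Q^+s_2)=\omega_\lambda(h)\,f(s_1^{-1}Q^-Q^+s_2),\qquad h\in H,\ s_1,s_2\in G.$$ Then $\widetilde R_\lambda$ acts on $\mathcal D_\lambda(\mathcal C)$ by $\big(\widetilde R_\lambda(g_1,g_2)f\big)(y)=f(g_1^{-1}yg_2)$. **Realization on $G/H$.** Let $\mathcal X\subset\mathcal C$ consist of the cosets $x=s^{-1}Q^-Q^+s$, $s\in G$. It is identified with $G/H$ by $s^{-1}Q^-Q^+s\leftrightarrow Hs$. Restricting functions $f\in\mathcal D_\lambda(\mathcal C)$ to $\mathcal X$ one obtains the realization of $\widetilde R_\lambda$ in functions on $\mathcal X=G/H$: for $x=s^{-1}Q^-Q^+s$, write (when possible) $$sg_2g_1^{-1}s^{-1}=\exp(-Y^* )\cdot\exp X^*\cdot h^*,\qquad X^*\in\mathfrak q^-,\ Y^*\in\mathfrak q^+,\ h^*\in H,$$ put $s^*=\exp Y^*\cdot sg_2=\exp X^*\cdot h^*sg_1$ and $x^*=(s^* )^{-1}Q^-Q^+s^*\in\mathcal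 X$. Then $\big(\widetilde R_\lambda(g_1,g_2)f\big)(x)=\omega_\lambda(h^* )f(x^* )$, where $\omega_\lambda(h^* )$ and $x^*$ do not depend on the choice of the representative $s$. A function $f$ on $\mathcal X$ is written $f(\xi,\eta)$ in horospherical coordinates. *)

(* Defs.v *)
From HB Require Import structures.
From mathcomp Require Import all_boot all_order all_algebra.
From mathcomp Require Import all_classical all_reals all_analysis.
From mathcomp Require Import complex.
From mathcomp Require mpoly.
(* The notations of mpoly clash with those of the analysis library. *)
Import -(notations) mpoly.

Set Implicit Arguments.
Unset Strict Implicit.
Unset Printing Implicit Defensive.

Import Order.TTheory GRing.Theory Num.Theory.
Import numFieldNormedType.Exports.

Local Open Scope classical_set_scope.
Local Open Scope ring_scope.
Local Open Scope complex_scope.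

Section Smoothness.
Context {R : realType}.

(* On finite-dimensional V (the only case used below) this is the usual class
   C^infinity: f is Frechet differentiable at every point of the open set U, as
   are all its iterated directional derivatives. *)
Fixpoint differentiable_upto {V W : normedModType R} (k : nat) (U : set V)
    (f : V -> W) : Prop :=
  match k with
  | 0 => forall x, U x -> {for x, continuous f}
  | k'.+1 => (forall x, U x -> differentiable f x) /\
             (forall v, differentiable_upto k' U (fun x => 'D_v f x))
  end.

Definition smooth_on {V W : normedModType R} (U : set V) (f : V -> W) : Prop :=
  open U /\ forall k, differentiable_upto k U f.

(* A chart is a partial map; cmap is meaningful on cdom only, cinv on the image
   of cdom only. *)
Record chart (V : normedModType R) (M : Type) := Chart {
  cdom : set M;
  cmap : M -> V;
  cinv : V -> M }.

Definition cimage (V : normedModType R) M (c : chart V M) : set V :=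
  cmap c @` cdom c.

Definition chart_axiom (V : normedModType R) (M : topologicalType)
    (c : chart V M) : Prop :=
  [/\ open (cdom c), open (cimage c),
      forall p, cdom c p -> cinv c (cmap c p) = p,
      forall p, cdom c p -> {for p, continuous (cmap c)} &
      forall x, cimage c x -> {for x, continuous (cinv c)}].

(* smooth_on contains the openness of the set on which the local expression is
   defined, so that smooth maps are continuous. *)
Definition smooth_map (V W : normedModType R) (M N : Type)
    (A : set (chart V M)) (B : set (chart W N)) (f : M -> N) : Prop :=
  forall c d, A c -> B d ->
    smooth_on [set x | cimage c x /\ cdom d (f (cinv c x))]
              (fun x => cmap d (f (cinv c x))).

Definition id_atlas (V : normedModType R) : set (chart V V) :=
  [set Chart setT id id].

Definition prod_chart (V W : normedModType R) (M N : Type)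
    (c : chart V M) (d : chart W N) : chart (V * W)%type (M * N)%type :=
  Chart (cdom c `*` cdom d)
        (fun p => (cmap c p.1, cmap d p.2))
        (fun x => (cinv c x.1, cinv d x.2)).

Definition prod_atlas (V W : normedModType R) (M N : Type)
    (A : set (chart V M)) (B : set (chart W N)) :
    set (chart (V * W)%type (M * N)%type) :=
  [set prod_chart c d | c in A & d in B].

End Smoothness.

Arguments id_atlas {R} V.

(* Real Lie groups of dimension n: compatibility of the charts is the
   smoothness of the identity map. *)
HB.mixin Record isLieGroup (R : realType) (n : nat) G
    of monoid.Group G & Topological G := {
  lie_atlas : set (chart 'rV[R]_n G);
  lie_atlas_chart : forall c, lie_atlas c -> chart_axiom c;
  lie_atlas_cover : forall g : G, exists2 c, lie_atlas c & cdom c g;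
  lie_atlas_compat : smooth_map lie_atlas lie_atlas (fun g : G => g);
  lie_hausdorff : hausdorff_space G;
  lie_second_countable : @second_countable G;
  lie_mul_smooth : smooth_map (prod_atlas lie_atlas lie_atlas) lie_atlas
                     (fun p : G * G => (p.1 * p.2)%g);
  lie_inv_smooth : smooth_map lie_atlas lie_atlas (fun g : G => (g^-1)%g)
}.

#[short(type="lieGroupType")]
HB.structure Definition LieGroup (R : realType) (n : nat) :=
  {G of isLieGroup R n G & monoid.Group G & Topological G}.

Section LieAlgebra.
Context {R : realType} {n : nat} (G : lieGroupType R n).

Definition atlas_of : set (chart 'rV[R]_n G) := lie_atlas.

(* The Lie algebra is the tangent space at the identity; a chart around the
   identity identifies it with 'rV[R]_n. *)
Definition chart1 : chart 'rV[R]_n G := s2val (cid2 (lie_atlas_cover (1%g : G))).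

Definition origin1 : 'rV[R]_n := cmap chart1 1%g.

(* Differential at the identity of a map fixing the identity. *)
Definition tangent1 (f : G -> G) (X : 'rV[R]_n) : 'rV[R]_n :=
  'D_X (fun x : 'rV[R]_n => cmap chart1 (f (cinv chart1 x))) origin1.

Definition Ad (g : G) : 'rV[R]_n -> 'rV[R]_n :=
  tangent1 (fun x => g * x * g^-1)%g.

(* [X, Y] = (d Ad)(X) Y. *)
Definition lie_bracket (X Y : 'rV[R]_n) : 'rV[R]_n :=
  'D_X (fun x : 'rV[R]_n => Ad (cinv chart1 x) Y) origin1.

(* t |-> e (t X) is the one-parameter subgroup with velocity X. *)
Definition is_lie_exp (e : 'rV[R]_n -> G) : Prop :=
  forall X : 'rV[R]_n,
  [/\ smooth_map (id_atlas R^o) atlas_of (fun t : R^o => e (t *: X)),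
      forall s t : R, e ((s + t) *: X) = (e (s *: X) * e (t *: X))%g &
      'D_1 (fun t : R^o => cmap chart1 (e (t *: X))) 0 = X].

(* Subspaces of the Lie algebra are row spaces of matrices. *)
Definition is_ideal (I : 'M[R]_n) : Prop :=
  forall X Y : 'rV[R]_n, (Y <= I)%MS -> (lie_bracket X Y <= I)%MS.

Definition simple_lie_algebra : Prop :=
  (exists X Y, lie_bracket X Y <> 0) /\
  (forall I : 'M[R]_n, is_ideal I -> I = 0 \/ row_full I).

End LieAlgebra.

Arguments atlas_of {R n} G _.

Section ParaHermitian.
Context {R : realType} {n : nat} {G : lieGroupType R n}.

Record symmetric_data := SymmetricData {
  sd_exp : 'rV[R]_n -> G;
  sd_sigma : G -> G;
  sd_H : set G;
  sd_Z0 : 'rV[R]_n }.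

Context (S : symmetric_data).
Local Notation e := (sd_exp S).
Local Notation sigma := (sd_sigma S).
Local Notation H := (sd_H S).
Local Notation Z0 := (sd_Z0 S).

Definition lie_h : 'M[R]_n := eigenspace (lin1_mx (tangent1 sigma)) 1.
Definition lie_q : 'M[R]_n := eigenspace (lin1_mx (tangent1 sigma)) (-1).
Definition ad_Z0 : 'M[R]_n := lin1_mx (lie_bracket G Z0).
Definition qplus : 'M[R]_n := (lie_q :&: eigenspace ad_Z0 1)%MS.
Definition qminus : 'M[R]_n := (lie_q :&: eigenspace ad_Z0 (-1))%MS.

Definition Qplus : set G := [set e Y | Y in [set Y : 'rV[R]_n | (Y <= qplus)%MS]].
Definition Qminus : set G := [set e X | X in [set X : 'rV[R]_n | (X <= qminus)%MS]].

Definition prod3 (A B C : set G) : set G :=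
  [set g | exists a b c, [/\ A a, B b, C c & g = (a * b * c)%g]].

Definition is_subgroup (K : set G) : Prop :=
  [/\ K 1%g, forall x y, K x -> K y -> K (x * y)%g & forall x, K x -> K (x^-1)%g].

Definition involutive_automorphism : Prop :=
  [/\ smooth_map (atlas_of G) (atlas_of G) sigma,
      forall x y, sigma (x * y)%g = (sigma x * sigma y)%g,
      forall x, sigma (sigma x) = x &
      exists x, sigma x <> x].

Record para_hermitian : Prop := ParaHermitian {
  ph_exp : is_lie_exp e;
  ph_connected : connected [set: G];
  ph_simple : simple_lie_algebra G;
  ph_involution : involutive_automorphism;
  ph_subgroup : is_subgroup H;
  ph_open : exists2 O : set G, open O & H = O `&` [set g | sigma g = g];
  ph_center : forall X : 'rV[R]_n,
    (X <= lie_h)%MS /\ (forall Y, (Y <= lie_h)%MS -> lie_bracket G X Y = 0) <->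
    exists t : R, X = t *: Z0;
  ph_stabilizer : H = [set g | Ad g Z0 = Z0];
  ph_diag : (qminus + qplus :=: lie_q)%MS;
  ph_bigcell_pm : open (prod3 Qplus H Qminus) /\ dense (prod3 Qplus H Qminus);
  ph_bigcell_mp : open (prod3 Qminus H Qplus) /\ dense (prod3 Qminus H Qplus) }.

(* xi' is the action of g on xi, with H-component h. *)
Definition qminus_act (xi : 'rV[R]_n) (g h : G) (xi' : 'rV[R]_n) : Prop :=
  [/\ H h, (xi' <= qminus)%MS &
      exists2 Y : 'rV[R]_n, (Y <= qplus)%MS & (e xi * g = e Y * h * e xi')%g].

Definition qplus_act (eta : 'rV[R]_n) (g h : G) (eta' : 'rV[R]_n) : Prop :=
  [/\ H h, (eta' <= qplus)%MS &
      exists2 X : 'rV[R]_n, (X <= qminus)%MS & (e eta * g = e X * h * e eta')%g].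

Definition horo_decomp (xi eta X Y : 'rV[R]_n) (h : G) : Prop :=
  [/\ (X <= qminus)%MS, (Y <= qplus)%MS, H h &
      (e xi * e (- eta) = e (- Y) * e X * h)%g].

Definition translate (a : G) (y : set G) (b : G) : set G :=
  [set (a * z * b)%g | z in y].

Definition QmQp : set G := [set (x * y)%g | x in Qminus & y in Qplus].

Definition double_coset (s1 s2 : G) : set G := translate (s1^-1)%g QmQp s2.

(* The point s^-1 Q^- Q^+ s of X, identified with the coset H s. *)
Definition point (s : G) : set G := double_coset s s.

Definition has_horo_coord (x : set G) (xi eta : 'rV[R]_n) : Prop :=
  exists X Y h, horo_decomp xi eta X Y h /\ x = point (e Y * e xi)%g.

Definition qpair : set ('rV[R]_n * 'rV[R]_n) :=
  [set p | (p.1 <= qminus)%MS /\ (p.2 <= qplus)%MS].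

Definition horo_domain (g1 g2 : G) : set ('rV[R]_n * 'rV[R]_n) :=
  qpair `&` [set p | exists h2 h1 xi' eta' x x',
    [/\ qminus_act p.1 g2 h2 xi', qplus_act p.2 g1 h1 eta',
        has_horo_coord x p.1 p.2 & has_horo_coord x' xi' eta']].

(* Matrix of Ad h on q^+ in the basis row_base qplus. *)
Definition b_char (h : G) : R := \det (restrictmx qplus (lin1_mx (Ad h))).

(* Polynomials on q^- x q^+, in the coordinates given by the bases
   row_base qminus (first block of variables) and row_base qplus. *)
Definition pair_poly := mpoly.mpoly (\rank qminus + \rank qplus) R.

Definition pair_coord (xi eta : 'rV[R]_n) (i : 'I_(\rank qminus + \rank qplus)) : R :=
  match fintype.split i with
  | inl j => (xi *m pinvmx (row_base qminus)) ord0 j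
  | inr j => (eta *m pinvmx (row_base qplus)) ord0 j
  end.

Definition pair_eval (P : pair_poly) (xi eta : 'rV[R]_n) : R :=
  mpoly.meval (pair_coord xi eta) P.

Definition pair_irreducible (P : pair_poly) : Prop :=
  [/\ P != 0, P \isn't a GRing.unit &
      forall A B : pair_poly, P = A * B ->
        (A \is a GRing.unit) || (B \is a GRing.unit)].

Definition degree_minus (P : pair_poly) : nat :=
  (\max_(m <- mpoly.msupp P) \sum_(j < \rank qminus) m (lshift (\rank qplus) j))%N.
Definition degree_plus (P : pair_poly) : nat :=
  (\max_(m <- mpoly.msupp P) \sum_(j < \rank qplus) m (rshift (\rank qminus) j))%N.

Definition jtriple (X Y Z : 'rV[R]_n) : 'rV[R]_n :=
  2^-1 *: lie_bracket G (lie_bracket G X Y) Z.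

(* jpow x y k is the power x^(k+1, y), that is, the (k+1)-st power of x in the
   Jordan algebra q^+ with product a, b |-> {a y b}. *)
Fixpoint jpow (x y : 'rV[R]_n) (k : nat) : 'rV[R]_n :=
  if k is k'.+1 then jtriple x y (jpow x y k') else x.

Definition jpow_mx (x y : 'rV[R]_n) (k : nat) : 'M[R]_(k, n) :=
  \matrix_(i < k) jpow x y i.

(* The rank is the degree of the generic minimum polynomial. *)
Definition jordan_rank (r : nat) : Prop :=
  (exists x y, [/\ (x <= qplus)%MS, (y <= qminus)%MS & row_free (jpow_mx x y r)]) /\
  (forall x y k, (x <= qplus)%MS -> (y <= qminus)%MS ->
     row_free (jpow_mx x y k) -> (k <= r)%N).

(* D = m(1, x, y) for the generic minimum polynomial
   m(T, x, y) = T^r - m_1(x, y) T^(r-1) + ... + (-1)^r m_r(x, y)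
   (here m_(i+1) is m i), whose coefficients are the polynomials with
   x^(r+1, y) - m_1(x, y) x^(r, y) + ... + (-1)^r m_r(x, y) x^(1, y) = 0. *)
Definition generic_norm (D : pair_poly) : Prop :=
  exists r (m : 'I_r -> pair_poly),
  [/\ jordan_rank r,
      forall x y, (x <= qplus)%MS -> (y <= qminus)%MS ->
        jpow x y r =
        \sum_(i < r) ((-1) ^+ i * pair_eval (m i) y x) *: jpow x y (r - i.+1) &
      D = 1 - \sum_(i < r) (-1) ^+ i * m i].

(* In the normalization {X Y Z} = [[X, Y], Z] / 2 the quadratic operators are
   Q(x) z = {x z x}, and B(x, y) = 1 - 2 {x y .} + Q(x) Q(y). *)
Definition bergman (x y z : 'rV[R]_n) : 'rV[R]_n :=
  z - 2 *: jtriple x y z + jtriple x (jtriple y z y) x.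

(* The genus k of a simple Jordan pair: det B(x, y) is the k-th power of the
   generic norm. *)
Definition jordan_genus (k : nat) : Prop :=
  (0 < k)%N /\
  exists2 D, generic_norm D &
    forall x y, (x <= qplus)%MS -> (y <= qminus)%MS ->
      \det (restrictmx qplus (lin1_mx (bergman x y))) = pair_eval D y x ^+ k.

(* |a|^l for a <> 0 *)
Definition abs_cpow (a : R) (l : R[i]) : R[i] :=
  let t := ln `|a| in
  (expR (complex.Re l * t))%:C * (cos (complex.Im l * t) +i* sin (complex.Im l * t)).

Definition omega (kappa : nat) (lambda : R[i]) (h : G) : R[i] :=
  abs_cpow (b_char h) (- lambda / kappa%:R).

Definition Phi (N : pair_poly) (lambda : R[i]) (xi eta : 'rV[R]_n) : R[i] :=
  abs_cpow (pair_eval N xi eta) lambda.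

(* Functions on C are given by functions on subsets of G, only the values at
   double cosets being relevant. The manifold C is homogeneous under G x G, so
   smoothness on C is smoothness of the lift to G x G. *)
Definition D_space (kappa : nat) (lambda : R[i]) (f : set G -> R[i]) : Prop :=
  [/\ smooth_map (prod_atlas (atlas_of G) (atlas_of G)) (id_atlas R^o)
        (fun p : G * G => complex.Re (f (double_coset p.1 p.2)) : R^o),
      smooth_map (prod_atlas (atlas_of G) (atlas_of G)) (id_atlas R^o)
        (fun p : G * G => complex.Im (f (double_coset p.1 p.2)) : R^o) &
      forall h s1 s2, H h ->
        f (translate (s1^-1 * h)%g QmQp s2) =
        omega kappa lambda h * f (double_coset s1 s2)].

Definition R_rep (g1 g2 : G) (f : set G -> R[i]) : set G -> R[i] :=
  fun y => f (translate (g1^-1)%g y g2).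

End ParaHermitian.

(* Main.v *)
Require Import Defs.
From HB Require Import structures.
From mathcomp Require Import all_boot all_order all_algebra.
From mathcomp Require Import all_classical all_reals all_analysis.
From mathcomp Require Import complex ring lra.
From mathcomp Require mpoly.
Import -(notations) mpoly.
Import Order.TTheory GRing.Theory Num.Theory.
Import numFieldNormedType.Exports.
Local Open Scope classical_set_scope.
Local Open Scope ring_scope.
Local Open Scope complex_scope.

Set Implicit Arguments.
Unset Strict Implicit.
Unset Printing Implicit Defensive.

(* Write [a s = e (s Z0)]. The operators [Ad (a s)] act on q^-, h, q^+ by
   [exp (- s)], [1], [exp s]; comparing the orders in s of both sides of
   [Ad (a s) Ad (e X) = Ad (e (exp s X)) Ad (a s)] shows that [Ad (e X)] is the
   identity on q^+ for X in q^+, so that exp is a homomorphism on q^+, and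
   likewise on q^-. Hence Q^-Q^+ is stable under multiplication by Q^- on the
   left, by Q^+ on the right, and under conjugation by H. Writing the point with
   horospherical coordinates (xi, eta) as [s = e Y e xi = e X h e eta], the coset
   [(s g1)^-1 Q^-Q^+ (s g2)] becomes
   [(e eta')^-1 h1^-1 h^-1 h2 Q^-Q^+ e xi'], and the formula is the
   multiplicativity of omega on H together with [omega h = Phi xi eta].

   The same stability shows that (xi, eta) lies in the domain if and only if
   [e xi g2], [e xi e (- eta)] and [e xi g2 g1^-1 e (- eta)] lie in the open
   dense set Q^+HQ^- and [e eta g1] lies in Q^-HQ^+. These are open conditions;
   density follows from the continuity at 1 of the q^--coordinate of Q^+HQ^-:
   if [p = e X k e Y] then [Ad p^-1 (Z0 - X) = Z0 - Y], and X, Y lie in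
   complementary spaces, so that Y is small when p is close to 1. *)

(** * Differential calculus *)

Section Calculus.
Context {R : realType}.
Implicit Types U V W : normedModType R.

(** The little-o expansion of [f] at [a] depends only on the germ of [f], so it is also an expansion
    of [g], with the same linear part. *)
Lemma near_eq_differentiable V W (f g : V -> W) (a : V) :
  (\forall x \near a, f x = g x) -> differentiable f a -> differentiable g a.
Proof.
move=> fg df; have fga := nbhs_singleton fg.
have [dc /eqaddoP fE] := (diff_locallyP a f).1 df.
have gE : g \o shift a = cst (g a) + 'd f a +o_0 id.
  apply/eqaddoP => eps eps0.
  have := fE eps eps0; apply: filterS2; last first.
    have H := fg; rewrite (near_shift 0 a [set x | f x = g x]) in H; exact: H.
  by move=> x; rewrite /= subr0 => fgx; rewrite /= !fctE /= fgx fga.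
have dE : 'd g a = 'd f a :> (V -> W) by apply: diff_unique.
by apply/diff_locallyP; rewrite dE.
Qed.

Lemma derive_line V W (f : V -> W) (t u : V) :
  'D_u f t = 'D_1 (fun h : R => f (h *: u + t)) 0.
Proof.
rewrite /derive; set a := fun h => _; set b := fun h => _.
suff -> : a = b by [].
by apply/funext => h; rewrite /a /b /= scale0r add0r addr0 [_%:A]mulr1.
Qed.

Lemma is_derive_line V W (f : V -> W) (t u : V) (d : W) :
  is_derive (0 : R) 1 (fun h : R => f (h *: u + t)) d -> is_derive t u f d.
Proof.
move=> [dg gE]; have df : derivable f t u by apply/(derivable1P f t u).
by rewrite -gE -derive_line; exact: DeriveDef.
Qed.

(** The inner map need only be derivable along [u]: restricted to the line through [t] it is a
    curve, for which derivability is differentiability, and the chain rule for differentials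
    applies. *)
Lemma is_derive_comp_diff U V W (g : U -> V) (f : V -> W) (t u : U) (v : V) :
  is_derive t u g v -> differentiable f (g t) ->
  is_derive t u (f \o g) ('D_v f (g t)).
Proof.
move=> [dg gE] df.
pose c (h : R) := g (h *: u + t).
have cd : differentiable c 0.
  by apply/derivable1_diffP; exact: (derivable1P g t u).1 dg.
have c0 : c 0 = g t by rewrite /c scale0r add0r.
have dfc : differentiable (f \o c) 0.
  by apply: differentiable_comp => //; rewrite c0.
have <- : 'D_1 (f \o c) 0 = 'D_v f (g t).
  rewrite deriveE// diff_comp //= ?c0 // -(deriveE _ cd) -derive_line gE.
  by rewrite -deriveE.
apply: is_derive_line; apply: DeriveDef => //.
exact/(derivable1_diffP (f \o c)).
Qed.

Lemma is_derive_pair U V W (f : U -> V) (g : U -> W) (t u : U) (v : V) (w : W) :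
  is_derive t u f v -> is_derive t u g w ->
  is_derive t u (fun s => (f s, g s)) (v, w).
Proof.
move=> [df fE] [dg gE].
have H : (fun h : R => h^-1 *: (((fun s => (f s, g s)) \o shift t) (h *: u) -
    (f t, g t))) @ 0^' --> (v, w).
  rewrite -fE -gE; exact: (cvg_pair df dg).
apply: DeriveDef; first by apply/cvg_ex; exists (v, w).
exact: cvg_lim H.
Qed.

Lemma derive_linear V W (f : V -> W) (a : V) :
  differentiable f a -> linear (fun v => 'D_v f a).
Proof. by move=> df k v w; rewrite !deriveE// linearP. Qed.

Lemma derive_pair_split U V W (f : U * V -> W) a u v : differentiable f a ->
  'D_(u, v) f a = 'D_(u, 0) f a + 'D_(0, v) f a.
Proof.
move=> df; rewrite !deriveE// -linearD; congr ('d f a _).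
by congr (_, _); rewrite ?addr0 ?add0r.
Qed.

(** This trades a varying direction for fixed ones with varying coefficients, since the iterated
    derivatives in [differentiable_upto] are taken along fixed directions. *)
Lemma derive_row_basis n V W (f : 'rV[R]_n * V -> W) a w :
  differentiable f a ->
  'D_(w, 0) f a = \sum_k w ord0 k *: 'D_(delta_mx ord0 k, 0) f a.
Proof.
move=> df; rewrite deriveE//.
under eq_bigr do rewrite deriveE// -linearZ.
rewrite -linear_sum; congr ('d f a _).
transitivity ((\sum_k (w ord0 k *: delta_mx ord0 k : 'rV[R]_n), 0 : V)).
  by congr (_, _); rewrite [LHS]row_sum_delta.
elim/big_rec2: _ => // k x y _ <-; congr (_, _); rewrite /=.
by rewrite scaler0 addr0.
Qed.

Lemma continuous_near_eq (S T : topologicalType) (f g : S -> T) (x : S) :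
  (\forall y \near x, f y = g y) -> {for x, continuous f} ->
  {for x, continuous g}.
Proof.
move=> fg cf; have fgx : f x = g x := nbhs_singleton fg.
suff : g @ x --> f x by rewrite fgx.
by apply: cvg_trans cf; apply: near_eq_cvg; apply: filterS fg => y ->.
Qed.

(** The mean value theorem, applied to each coordinate. *)
Lemma derive0_locally_constant n (g : R -> 'rV[R]_n) (r t : R) :
  (forall s : R, `|s| < r -> is_derive s 1 g 0) -> `|t| < r -> g t = g 0.
Proof.
move=> dg tr; apply/rowP => i.
pose h (s : R) := g s ord0 i.
have dh (s : R) : `|s| < r -> is_derive s 1 h 0.
  move=> sr; have [d1 d2] := dg s sr.
  have dh : derivable h s 1 by exact: (derivable_mxP g s 1).1 d1 _ _.
  suff <- : 'D_1 h s = 0 by exact: DeriveDef.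
  by move/matrixP: (derive_mx d1) => /(_ ord0 i); rewrite d2 !mxE => <-.
have itv a b s : `|a| < r -> `|b| < r -> a <= s <= b -> `|s| < r.
  rewrite !ltr_norml => /andP[a1 _] /andP[_ b2] /andP[s1 s2].
  by rewrite (lt_le_trans a1 s1) (le_lt_trans s2 b2).
have r0 : `|0 : R| < r by rewrite normr0 (le_lt_trans _ tr).
have key a b : `|a| < r -> `|b| < r -> a <= b -> h a = h b.
  move=> ar br ab; have [| |c _] := @MVT_segment R h (fun=> 0) a b ab.
  - move=> x /[!in_itv]/= /andP[x1 x2]; apply: dh.
    by apply: (itv a b) => //; rewrite !ltW.
  - apply: continuous_in_subspaceT => x /[!inE]/=; rewrite in_itv/= => xab.
    have [d1 _] := dh x (itv a b x ar br xab).
    exact/differentiable_continuous/derivable1_diffP.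
  by rewrite mul0r => /eqP; rewrite subr_eq0 => /eqP.
have [t0|t0] := leP t 0; first exact: key.
by apply/esym/key => //; exact: ltW.
Qed.

End Calculus.

(** * Lie groups and the adjoint representation *)

Section Charts.
Context {R : realType}.

Lemma smooth_map_local (V W : normedModType R) (M N : Type)
    (A : set (chart V M)) (B : set (chart W N)) f c d p :
  smooth_map A B f -> A c -> B d -> cdom c p -> cdom d (f p) ->
  cinv c (cmap c p) = p ->
  exists U, [/\ open U, U (cmap c p),
    U `<=` [set x | cimage c x /\ cdom d (f (cinv c x))] &
    forall k, differentiable_upto k U (fun x => cmap d (f (cinv c x)))].
Proof.
move=> sf Ac Bd cp dp cK; have [oU dU] := sf c d Ac Bd.
exists [set x | cimage c x /\ cdom d (f (cinv c x))]; split => //=.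
by rewrite cK; split => //; exists p.
Qed.

(** Near [p] the map is its local expression between the two charts; the openness contained in
    [smooth_on] makes this hold on a neighbourhood. The properties of [c] are listed one by one so
    that product charts and the identity chart of the line are covered. *)
Lemma smooth_map_continuous (V W : normedModType R) (M N : topologicalType)
    (A : set (chart V M)) (B : set (chart W N)) f c d p :
  smooth_map A B f -> A c -> B d ->
  nbhs p (cdom c) -> {for p, continuous (cmap c)} ->
  (forall q, cdom c q -> cinv c (cmap c q) = q) ->
  chart_axiom d -> cdom d (f p) -> {for p, continuous f}.
Proof.
move=> sf Ac Bd ncp cc cK [oD oI dK dc dic] dp.
have cp := nbhs_singleton ncp.
have [U [oU Ux Usub dU]] := smooth_map_local sf Ac Bd cp dp (cK _ cp).
pose F x := cmap d (f (cinv c x)).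
have Fx : F (cmap c p) = cmap d (f p) by rewrite /F cK.
have cF : {for cmap c p, continuous F} by exact: (dU 0%N).
have cG : {for p, continuous (cinv d \o (F \o cmap c))}.
  apply: continuous_comp; first exact: continuous_comp.
  by rewrite /= Fx; apply: dic; exists (f p).
apply: continuous_near_eq cG.
have : \forall q \near p, U (cmap c q) by apply: cc; exact: open_nbhs_nbhs.
apply: filterS2 ncp => q cq Uq /=.
have [_] := Usub _ Uq; rewrite cK// => dq.
by rewrite /F cK // dK.
Qed.

End Charts.

(** * The group operations in charts and tangent maps at the identity *)

Section LieLocal.
Context {R : realType} {n : nat} (G : lieGroupType R n).
Local Notation phi := (cmap (chart1 G)).
Local Notation psi := (cinv (chart1 G)).
Local Notation o := (origin1 G).
Local Notation dom := (cdom (chart1 G)).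

Lemma chart1_atlas : lie_atlas (chart1 G).
Proof. exact: s2valP (cid2 (lie_atlas_cover (1%g : G))). Qed.

Lemma chart1_dom1 : dom (1%g : G).
Proof. exact: s2valP' (cid2 (lie_atlas_cover (1%g : G))). Qed.

Lemma chart_near (c : chart 'rV[R]_n G) p : lie_atlas c -> cdom c p ->
  \forall q \near p, cdom c q.
Proof. by move=> /lie_atlas_chart[oD *]; apply: open_nbhs_nbhs; split. Qed.

Lemma chart_near_image (c : chart 'rV[R]_n G) p : lie_atlas c -> cdom c p ->
  \forall x \near cmap c p, cimage c x.
Proof.
by move=> /lie_atlas_chart[_ oI *]; apply: open_nbhs_nbhs; split=> //; exists p.
Qed.

Lemma chart_inv_map (c : chart 'rV[R]_n G) p : lie_atlas c -> cdom c p ->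
  cinv c (cmap c p) = p.
Proof. by move=> /lie_atlas_chart[_ _ + _ _]; exact. Qed.

Lemma chart_map_inv (c : chart 'rV[R]_n G) x : lie_atlas c -> cimage c x ->
  cdom c (cinv c x) /\ cmap c (cinv c x) = x.
Proof. by move=> Ac [p cp <-]; rewrite chart_inv_map. Qed.

Lemma chart_map_continuous (c : chart 'rV[R]_n G) p : lie_atlas c ->
  cdom c p -> {for p, continuous (cmap c)}.
Proof. by move=> /lie_atlas_chart[_ _ _ + _]; exact. Qed.

Lemma chart_inv_continuous (c : chart 'rV[R]_n G) p : lie_atlas c ->
  cdom c p -> {for cmap c p, continuous (cinv c)}.
Proof. by move=> /lie_atlas_chart[_ _ _ _ H] cp; apply: H; exists p. Qed.

Lemma prod_chart_near (c d : chart 'rV[R]_n G) p q :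
  lie_atlas c -> lie_atlas d -> cdom c p -> cdom d q ->
  nbhs (p, q) (cdom (prod_chart c d)).
Proof.
by move=> Ac Ad cp dq; exists (cdom c, cdom d) => //; split; exact: chart_near.
Qed.

Lemma prod_chart_continuous (c d : chart 'rV[R]_n G) p q :
  lie_atlas c -> lie_atlas d -> cdom c p -> cdom d q ->
  {for (p, q), continuous (cmap (prod_chart c d))}.
Proof.
move=> Ac Ad cp dq.
have c1 : {for (p, q), continuous (cmap c \o fst)}.
  by apply: continuous_comp; [exact: cvg_fst|exact: chart_map_continuous].
have c2 : {for (p, q), continuous (cmap d \o snd)}.
  by apply: continuous_comp; [exact: cvg_snd|exact: chart_map_continuous].
exact: cvg_pair c1 c2.
Qed.

Lemma lie_mul_continuous : continuous (fun p : G * G => (p.1 * p.2)%g : G).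
Proof.
case=> p q.
have [c Ac cp] := lie_atlas_cover p; have [d Ad dq] := lie_atlas_cover q.
have [b Ab bpq] := lie_atlas_cover (p * q)%g.
apply: (@smooth_map_continuous _ _ _ _ _ _ _ _ (prod_chart c d) b _
  (@lie_mul_smooth R n G)) => //.
- by exists c => //; exists d.
- exact: prod_chart_near.
- exact: prod_chart_continuous.
- by case=> p' q' [/= cp' dq'] /=; rewrite !chart_inv_map.
- exact: lie_atlas_chart.
Qed.

Lemma smooth_lie_map_continuous (f : G -> G) :
  smooth_map (atlas_of G) (atlas_of G) f -> continuous f.
Proof.
move=> sf p; have [c Ac cp] := lie_atlas_cover p.
have [d Ad dp] := lie_atlas_cover (f p).
apply: (@smooth_map_continuous _ _ _ _ _ _ _ _ c d _ sf) => //.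
- exact: chart_near.
- exact: chart_map_continuous.
- by move=> q cq; rewrite chart_inv_map.
- exact: lie_atlas_chart.
Qed.

Lemma lie_inv_continuous : continuous (fun p : G => (p^-1)%g : G).
Proof. exact/smooth_lie_map_continuous/lie_inv_smooth. Qed.

Lemma lie_mul_continuous_at (T : topologicalType) (f g : T -> G) (t : T) :
  {for t, continuous f} -> {for t, continuous g} ->
  {for t, continuous (fun s => (f s * g s)%g : G)}.
Proof.
move=> cf cg.
have h : {for t, continuous (fun s => (f s, g s))} by exact: cvg_pair cf cg.
have k := @lie_mul_continuous (f t, g t).
exact: (@continuous_comp _ _ _ (fun s => (f s, g s))
  (fun p : G * G => (p.1 * p.2)%g : G) t h k).
Qed.

(** The neighbourhood is chosen before [k]: the differentiability of [Ad] uses the first and second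
    orders on the same set. *)
Lemma lie_mul_upto (c1 c2 d : chart 'rV[R]_n G) (p q : G) :
  lie_atlas c1 -> lie_atlas c2 -> lie_atlas d ->
  cdom c1 p -> cdom c2 q -> cdom d (p * q)%g ->
  exists2 U, open_nbhs (cmap c1 p, cmap c2 q) U & forall k,
    differentiable_upto k U
      (fun x : 'rV[R]_n * 'rV[R]_n => cmap d (cinv c1 x.1 * cinv c2 x.2)%g).
Proof.
move=> A1 A2 Ad cp cq cpq.
have [|||||U [oU Ux _ dU]] :=
  @smooth_map_local _ _ _ _ _ _ _ _ (prod_chart c1 c2) d (p, q)
  (@lie_mul_smooth R n G) => //.
- by exists c1 => //; exists c2.
- by rewrite /= !chart_inv_map.
by exists U.
Qed.

Lemma lie_mul_diff (c1 c2 d : chart 'rV[R]_n G) (p q : G) :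
  lie_atlas c1 -> lie_atlas c2 -> lie_atlas d ->
  cdom c1 p -> cdom c2 q -> cdom d (p * q)%g ->
  differentiable
    (fun x : 'rV[R]_n * 'rV[R]_n => cmap d (cinv c1 x.1 * cinv c2 x.2)%g)
    (cmap c1 p, cmap c2 q).
Proof.
move=> A1 A2 Ad cp cq cpq; have [U [oU Ux] dU] := lie_mul_upto A1 A2 Ad cp cq cpq.
by have [+ _] := dU 1%N; exact.
Qed.

Lemma lie_mull_diff (c d : chart 'rV[R]_n G) (g h : G) :
  lie_atlas c -> lie_atlas d -> cdom c h -> cdom d (g * h)%g ->
  differentiable (fun x => cmap d (g * cinv c x)%g) (cmap c h).
Proof.
move=> Ac Ad ch dgh; have [b Ab bg] := lie_atlas_cover g.
have dm := lie_mul_diff Ab Ac Ad bg ch dgh.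
have : differentiable (fun x : 'rV[R]_n => (cmap b g, x)) (cmap c h).
  exact: differentiable_pair.
move=> /differentiable_comp => /(_ _ _ dm).
by rewrite /comp /= chart_inv_map.
Qed.

Lemma lie_mulr_diff (c d : chart 'rV[R]_n G) (g h : G) :
  lie_atlas c -> lie_atlas d -> cdom c h -> cdom d (h * g)%g ->
  differentiable (fun x => cmap d (cinv c x * g)%g) (cmap c h).
Proof.
move=> Ac Ad ch dgh; have [b Ab bg] := lie_atlas_cover g.
have dm := lie_mul_diff Ac Ab Ad ch bg dgh.
have : differentiable (fun x : 'rV[R]_n => (x, cmap b g)) (cmap c h).
  exact: differentiable_pair.
move=> /differentiable_comp => /(_ _ _ dm).
by rewrite /comp /= chart_inv_map.
Qed.

(** Continuity is a separate clause because [phi] is meaningful on the chart domain only: it keeps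
    [f (psi x)] in that domain for [x] near [o], so that local expressions can be composed. *)
Definition diff1 (f : G -> G) : Prop :=
  [/\ f 1%g = 1%g, {for 1%g, continuous f} & differentiable (phi \o f \o psi) o].

Lemma diff1_comp f g : diff1 f -> diff1 g -> diff1 (f \o g) /\
  forall X, tangent1 (f \o g) X = tangent1 f (tangent1 g X).
Proof.
move=> [f1 cf df] [g1 cg dg].
have A1 := chart1_atlas; have D1 := chart1_dom1.
have E : \forall x \near o, (phi \o f \o psi \o (phi \o g \o psi)) x =
    (phi \o (f \o g) \o psi) x.
  have : \forall x \near o, dom (g (psi x)).
    have c : {for o, continuous (g \o psi)}.
      apply: continuous_comp; first exact: chart_inv_continuous.
      by rewrite chart_inv_map.
    apply: c; rewrite /= chart_inv_map// g1.
    exact: chart_near.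
  apply: filterS2 (chart_near_image A1 D1) => x ix dx.
  by rewrite /= chart_inv_map.
have go : (phi \o g \o psi) o = o by rewrite /= chart_inv_map// g1.
have dfg : differentiable (phi \o f \o psi \o (phi \o g \o psi)) o.
  by apply: (differentiable_comp dg); rewrite go.
split.
  split; first by rewrite /= g1.
    by apply: continuous_comp => //; rewrite g1.
  exact: near_eq_differentiable E dfg.
move=> X; rewrite /tangent1.
rewrite -[RHS](_ : 'D_X (phi \o f \o psi \o (phi \o g \o psi)) o = _).
  by apply/esym; exact: near_eq_derive E.
have dg' : is_derive o X (phi \o g \o psi) ('D_X (phi \o g \o psi) o).
  exact/derivableP/diff_derivable.
rewrite -go in df; have [_] := is_derive_comp_diff dg' df.
by move=> ->; rewrite go.
Qed.

Lemma tangent1_linear f : diff1 f -> linear (tangent1 f).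
Proof. by move=> [_ _ df]; exact: derive_linear. Qed.

(** Left translation carries a neighbourhood of 1 to one of [g], right translation by [g^-1] carries
    it back; a chart around [g] serves in between. *)
Lemma diff1_conj g : diff1 (fun x => g * x * g^-1)%g.
Proof.
have A1 := chart1_atlas; have D1 := chart1_dom1.
split; first by rewrite mulg1 mulgV.
  apply: lie_mul_continuous_at; last exact: cst_continuous.
  by apply: lie_mul_continuous_at => //; exact: cst_continuous.
have [c Ac cg] := lie_atlas_cover g.
have dl : differentiable (fun x => cmap c (g * psi x)%g) o.
  by apply: lie_mull_diff => //; rewrite mulg1.
have dr : differentiable (fun x => phi (cinv c x * g^-1)%g) (cmap c g).
  by apply: lie_mulr_diff => //; rewrite mulgV.
have : differentiable ((fun x => phi (cinv c x * g^-1)%g) \o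
    (fun x => cmap c (g * psi x)%g)) o.
  by apply: (differentiable_comp dl); rewrite chart_inv_map// mulg1.
apply: near_eq_differentiable.
have : \forall x \near o, cdom c (g * psi x)%g.
  have : {for o, continuous (fun x => (g * psi x)%g : G)}.
    apply: lie_mul_continuous_at; first exact: cst_continuous.
    exact: chart_inv_continuous.
  by apply; rewrite chart_inv_map// mulg1; exact: chart_near.
by apply: filterS => x cx; rewrite /= chart_inv_map.
Qed.

Lemma Ad_mul (g h : G) X : Ad (g * h)%g X = Ad g (Ad h X).
Proof.
have [_ E] := diff1_comp (diff1_conj g) (diff1_conj h).
rewrite /Ad -E; congr (tangent1 _ X); apply/funext => x /=.
by rewrite invgM !mulgA.
Qed.

Lemma Ad_linear (g : G) : linear (Ad g).
Proof. exact/tangent1_linear/diff1_conj. Qed.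

Lemma Ad0 (g : G) : Ad g 0 = 0.
Proof.
by have := Ad_linear g (-1) 0 0; rewrite scaler0 addr0 scaleN1r addNr => ->.
Qed.

Lemma AdD (g : G) X Y : Ad g (X + Y) = Ad g X + Ad g Y.
Proof. by have := Ad_linear g 1 X Y; rewrite !scale1r. Qed.

Lemma AdZ (g : G) k X : Ad g (k *: X) = k *: Ad g X.
Proof. by have := Ad_linear g k X 0; rewrite !addr0 Ad0 addr0. Qed.

Lemma AdN (g : G) X : Ad g (- X) = - Ad g X.
Proof. by rewrite -scaleN1r AdZ scaleN1r. Qed.

Lemma tangent1_id X : tangent1 (id : G -> G) X = X.
Proof.
have A1 := chart1_atlas; have D1 := chart1_dom1.
rewrite /tangent1 -[RHS](derive_id o X); apply: near_eq_derive.
apply: filterS (chart_near_image A1 D1) => x ix.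
by have [] := chart_map_inv A1 ix.
Qed.

Lemma Ad1 X : Ad (1%g : G) X = X.
Proof.
rewrite -[RHS]tangent1_id /Ad; congr (tangent1 _ X); apply/funext => x.
by rewrite mul1g invg1 mulg1.
Qed.

Lemma AdK (g : G) : cancel (Ad g) (Ad (g^-1)%g).
Proof. by move=> X; rewrite -Ad_mul mulVg Ad1. Qed.

End LieLocal.

(** * One-parameter subgroups and the exponential map *)

Section Curves.
Context {R : realType} {n : nat} (G : lieGroupType R n).
Local Notation phi := (cmap (chart1 G)).
Local Notation psi := (cinv (chart1 G)).
Local Notation o := (origin1 G).
Local Notation dom := (cdom (chart1 G)).

(** As in [diff1], continuity is what keeps the curve in the chart domain for small [t]. *)
Definition has_velocity (c : R -> G) (v : 'rV[R]_n) : Prop :=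
  [/\ c 0 = 1%g, {for (0 : R), continuous c} &
      is_derive (0 : R) 1 (fun t : R => phi (c t)) v].

Lemma has_velocity_unique c v w :
  has_velocity c v -> has_velocity c w -> v = w.
Proof. by move=> [_ _ [_ <-]] [_ _ [_ <-]]. Qed.

(** The direction splits as [(v, 0) + (0, w)], and each partial map, multiplication by 1 on one
    side, is the identity in the chart. *)
Lemma derive_mulloc v w :
  'D_(v, w) (fun x : 'rV[R]_n * 'rV[R]_n => phi (psi x.1 * psi x.2)%g) (o, o) =
  v + w.
Proof.
have A1 := chart1_atlas G; have D1 := chart1_dom1 G.
have dm : differentiable
    (fun x : 'rV[R]_n * 'rV[R]_n => phi (psi x.1 * psi x.2)%g) (o, o).
  by apply: lie_mul_diff => //; rewrite mulg1.
rewrite derive_pair_split//; congr (_ + _).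
  have /(is_derive_comp_diff) /(_ dm)[_ <-] :
      is_derive o v (fun x : 'rV[R]_n => (x, o)) (v, 0).
    exact: is_derive_pair.
  rewrite -[RHS](derive_id o v); apply: near_eq_derive.
  apply: filterS (chart_near_image A1 D1) => x ix.
  by rewrite /= chart_inv_map// mulg1; have [] := chart_map_inv A1 ix.
have /(is_derive_comp_diff) /(_ dm)[_ <-] :
    is_derive o w (fun x : 'rV[R]_n => (o, x)) (0, w).
  exact: is_derive_pair.
rewrite -[RHS](derive_id o w); apply: near_eq_derive.
apply: filterS (chart_near_image A1 D1) => x ix.
by rewrite /= chart_inv_map// mul1g; have [] := chart_map_inv A1 ix.
Qed.

Lemma has_velocity_near_dom c v : has_velocity c v ->
  \forall t \near (0 : R), dom (c t).
Proof.
move=> [c0 cc _]; apply: cc; rewrite c0.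
exact: chart_near (chart1_atlas G) (chart1_dom1 G).
Qed.

Lemma has_velocity_mul c d v w : has_velocity c v -> has_velocity d w ->
  has_velocity (fun t => (c t * d t)%g) (v + w).
Proof.
move=> hc hd; have [c0 cc dc] := hc; have [d0 cd dd] := hd.
have A1 := chart1_atlas G; have D1 := chart1_dom1 G.
split; first by rewrite c0 d0 mulg1.
  exact: lie_mul_continuous_at.
have dm : differentiable
    (fun x : 'rV[R]_n * 'rV[R]_n => phi (psi x.1 * psi x.2)%g)
    (phi (c 0), phi (d 0)).
  by rewrite c0 d0; apply: lie_mul_diff => //; rewrite mulg1.
have := is_derive_comp_diff (is_derive_pair dc dd) dm.
rewrite [X in 'D__ _ X](_ : _ = (o, o)); last by rewrite c0 d0.
rewrite derive_mulloc; apply: near_eq_is_derive.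
apply: filterS2 (has_velocity_near_dom hc) (has_velocity_near_dom hd).
by move=> t ct dt; rewrite /= !chart_inv_map.
Qed.

Lemma has_velocity_map c v f : has_velocity c v -> diff1 f ->
  has_velocity (fun t => f (c t)) (tangent1 f v).
Proof.
move=> hc [f1 cf df]; have [c0 cc dc] := hc.
have A1 := chart1_atlas G; have D1 := chart1_dom1 G.
split; first by rewrite c0.
  by apply: continuous_comp => //; rewrite c0.
have df' : differentiable (phi \o f \o psi) (phi (c 0)) by rewrite c0.
have := is_derive_comp_diff dc df'.
rewrite c0; apply: near_eq_is_derive.
apply: filterS (has_velocity_near_dom hc).
by move=> t ct; rewrite /= !chart_inv_map.
Qed.

Lemma has_velocity_reparam c v (a : R -> R) (k : R) : has_velocity c v ->
  a 0 = 0 -> is_derive (0 : R) 1 a k -> has_velocity (c \o a) (k *: v).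
Proof.
move=> [c0 cc [dc dcE]] a0 da; have [da1 _] := da.
split; first by rewrite /= a0.
  apply: continuous_comp; last by rewrite a0.
  exact/differentiable_continuous/derivable1_diffP.
have dc' : differentiable (fun t : R => phi (c t)) (a 0).
  by rewrite a0; apply/derivable1_diffP.
have := is_derive_comp_diff da dc'.
by rewrite a0 -[X in 'D_X _ _]mulr1 deriveE ?linearZ -?deriveE ?dcE// -a0.
Qed.

Definition one_param (c : R -> G) : Prop :=
  forall s t : R, c (s + t) = (c s * c t)%g.

Lemma one_param0 c : one_param c -> c 0 = 1%g.
Proof. by move=> hc; apply: (@mulgI _ (c 0)); rewrite -hc addr0 mulg1. Qed.

Lemma one_paramN c t : one_param c -> c (- t) = (c t)^-1%g.
Proof.
by move=> hc; apply: (@mulgI _ (c t)); rewrite -hc subrr mulgV one_param0.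
Qed.

Lemma one_paramMn c t k : one_param c -> c (t *+ k) = (c t ^+ k)%g.
Proof.
move=> hc; elim: k => [|k IH]; first by rewrite mulr0n expg0 one_param0.
by rewrite mulrS hc IH expgS.
Qed.

(* [u t = c t d (- t)] satisfies
   [u (s + t) = (c t (c s d (- s)) (c t)^-1) u t], where the curve in s in
   parentheses has velocity 0; so u is locally constant near 0. *)
Lemma one_param_unique c d v : one_param c -> one_param d ->
  has_velocity c v -> has_velocity d v -> c =1 d.
Proof.
move=> hc hd vc vd; have [c0 cc _] := vc.
have A1 := chart1_atlas G; have D1 := chart1_dom1 G.
have vd' : has_velocity (d \o -%R) (-1 *: v).
  by apply: has_velocity_reparam => //; exact: oppr0.
have v0 : has_velocity (fun s => (c s * d (- s))%g) 0.
  by have := has_velocity_mul vc vd'; rewrite scaleN1r subrr.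
pose u t : G := (c t * d (- t))%g.
have du t : dom (u t) -> is_derive t 1 (fun t : R => phi (u t)) 0.
  move=> ut.
  have vw := has_velocity_map v0 (diff1_conj (c t)).
  have [w0 _ dw] := vw.
  have dr : differentiable (fun x => phi (psi x * u t)%g)
      (phi (c t * (c 0 * d (- 0)) * (c t)^-1)%g).
    by rewrite w0; apply: lie_mulr_diff => //; rewrite mul1g.
  have := is_derive_comp_diff dw dr.
  rewrite (_ : tangent1 _ 0 = 0); last exact: (Ad0 (c t)).
  rewrite derive0 => H; apply: is_derive_line.
  apply: near_eq_is_derive H.
  apply: filterS (has_velocity_near_dom vw) => s ws.
  rewrite /= chart_inv_map//; congr phi.
  rewrite [_ *: _]mulr1 /u -!mulgA mulKg [(s + t)]addrC hc -!mulgA.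
  by congr (_ * (_ * _))%g; rewrite -hd opprD addrC.
have u0 : \forall t \near (0 : R), dom (u t).
  exact: has_velocity_near_dom v0.
have /nbhs_ballP[r /= r0 br] := u0.
have small t : `|t| < r -> c t = d t.
  move=> tr.
  have : phi (u t) = phi (u 0).
    apply: (@derive0_locally_constant _ _ (fun t => phi (u t)) r) => // s sr.
    by apply: du; apply: br; rewrite -ball_normE /= sub0r normrN.
  have ut : dom (u t) by apply: br; rewrite -ball_normE /= sub0r normrN.
  have -> : u 0 = 1%g by rewrite /u oppr0 c0 one_param0 // mulg1.
  move=> /(congr1 psi); rewrite !chart_inv_map// /u one_paramN// => H.
  exact: divg1_eq.
move=> t.
(* As [k] exceeds [|t| / r], the point [t / k] lies in the interval where the two curves agree, and
   the values at [t] are [k]-th powers of those at [t / k]. *)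
pose k := (Num.bound (`|t| / r)).+1.
have tk : t = (t / k%:R) *+ k.
  by rewrite -mulr_natr divfK // pnatr_eq0.
rewrite tk !one_paramMn// small//.
rewrite normrM normfV normr_nat ltr_pdivrMr ?ltr0n // mulrC -ltr_pdivrMr //.
rewrite (lt_trans (archi_boundP _))// ?divr_ge0// ?ltW//.
by rewrite /k ltr_nat.
Qed.

End Curves.

Lemma is_derive_linear_comp (R : realType) (U V W : normedModType R)
    (L : {linear V -> W}) (c : U -> V) t u v :
  continuous L -> is_derive t u c v -> is_derive t u (L \o c) (L v).
Proof.
move=> cL dc; have dL : differentiable L (c t) by exact: linear_differentiable.
by have := is_derive_comp_diff dc dL; rewrite deriveE// diff_lin.
Qed.

(** * Regularity of the adjoint representation *)

Section AdRegularity.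
Context {R : realType} {n : nat} (G : lieGroupType R n).
Local Notation phi := (cmap (chart1 G)).
Local Notation psi := (cinv (chart1 G)).
Local Notation o := (origin1 G).
Local Notation dom := (cdom (chart1 G)).

Lemma differentiable_scale (V : normedModType R) (k : V -> R)
    (f : V -> 'rV[R]_n) x :
  differentiable k x -> differentiable f x ->
  differentiable (fun y => k y *: f y) x.
Proof.
move=> dk df.
have -> : (fun y => k y *: f y) =
    \sum_(j < n) (fun y => (k y * f y ord0 j) *: (delta_mx ord0 j : 'rV[R]_n)).
  apply/funext => y; rewrite fct_sumE [f y in LHS]row_sum_delta scaler_sumr.
  by apply: eq_bigr => j _; rewrite scalerA.
apply: differentiable_sum => j; apply: differentiableZl.
apply: differentiableM => //.
exact: (differentiable_comp df (differentiable_coord _ _ _)).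
Qed.

Lemma Ad_chart_diff Y : differentiable (fun x => Ad (psi x) Y) o.
Proof.
have A1 := chart1_atlas G; have D1 := chart1_dom1 G.
pose m (x : 'rV[R]_n * 'rV[R]_n) := phi (psi x.1 * psi x.2)%g.
have D11 : dom (1 * 1)%g by rewrite mulg1.
have [U [oU Uo] dU] := lie_mul_upto A1 A1 A1 D1 D1 D11.
have dm x : U x -> differentiable m x by move=> Ux; have [+ _] := dU 1%N; exact.
(* Second order of the multiplication: [F] below is built from first derivatives of [m]. *)
have ddm v x : U x -> differentiable (fun y => 'D_v m y) x.
  by move=> Ux; have [_ /(_ v)[+ _]] := dU 2%N; exact.
pose i x := phi (psi x)^-1%g.
have di : differentiable i o.
  have [|||V [oV Vo _ /(_ 1%N)[+ _]]] :=
    @smooth_map_local _ _ _ _ _ _ _ _ _ _ 1%g (@lie_inv_smooth R n G) A1 A1 => //.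
  - by rewrite invg1.
  - by rewrite chart_inv_map.
  - exact.
have io : i o = o by rewrite /i chart_inv_map// invg1.
have cpsi : {for o, continuous psi} by exact: chart_inv_continuous.
(* Near the identity [x y x^-1 = m (m (x, y), i x)]; the chain rule at [y = o]
   gives [Ad (psi x) Y = F x]. *)
pose F x := \sum_(k < n) 'D_(0, Y) m (x, o) ord0 k *:
  'D_(delta_mx ord0 k, 0) m (x, i x).
have dF : differentiable F o.
  have -> : F = \sum_(k < n) (fun x => 'D_(0, Y) m (x, o) ord0 k *:
      'D_(delta_mx ord0 k, 0) m (x, i x)).
    by apply/funext => x; rewrite fct_sumE.
  apply: differentiable_sum => k; apply: differentiable_scale.
    have d1 : differentiable (fun x : 'rV[R]_n => (x, o)) o.
      exact: differentiable_pair.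
    have d2 := differentiable_comp d1 (ddm (0, Y) _ Uo).
    exact: (differentiable_comp d2 (differentiable_coord _ _ _)).
  have d1 : differentiable (fun x : 'rV[R]_n => (x, i x)) o.
    exact: differentiable_pair.
  have Uio : U (o, i o) by rewrite io.
  exact: (differentiable_comp d1 (ddm (delta_mx ord0 k, 0) _ Uio)).
apply: near_eq_differentiable dF.
have n1 : \forall x \near o, U (x, o).
  have c : {for o, continuous (fun x : 'rV[R]_n => (x, o))}.
    by apply: differentiable_continuous; exact: differentiable_pair.
  by apply: c; exact: open_nbhs_nbhs.
have n2 : \forall x \near o, U (x, i x).
  have c : {for o, continuous (fun x : 'rV[R]_n => (x, i x))}.
    by apply: differentiable_continuous; exact: differentiable_pair.
  by apply: c; rewrite io; exact: open_nbhs_nbhs.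
have n3 : \forall x \near o, dom ((psi x)^-1)%g.
  have c : {for o, continuous (fun x => (psi x)^-1%g : G)}.
    by apply: (continuous_comp cpsi); exact: lie_inv_continuous.
  by apply: c; rewrite chart_inv_map// invg1; exact: chart_near.
have n4 := chart_near_image A1 D1.
near=> x.
have Ux1 : U (x, o) by near: x.
have Ux2 : U (x, i x) by near: x.
have dx3 : dom ((psi x)^-1)%g by near: x.
have ix : cimage (chart1 G) x by near: x.
have [dx px] := chart_map_inv A1 ix.
have mxo : m (x, o) = x by rewrite /m /= chart_inv_map// mulg1.
have E : \forall y \near o, (m \o (fun y => (m (x, y), i x))) y =
    phi (psi x * psi y * (psi x)^-1)%g.
  have : \forall y \near o, dom (psi x * psi y)%g.
    have c : {for o, continuous (fun y => (psi x * psi y)%g : G)}.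
      by apply: lie_mul_continuous_at => //; exact: cst_continuous.
    by apply: c; rewrite chart_inv_map// mulg1; exact: chart_near.
  by apply: filterS => y dy; rewrite /= /m /i /= !chart_inv_map.
rewrite /Ad /tangent1 -(near_eq_derive Y E).
have g1 : is_derive o Y (fun y => (m (x, y), i x)) ('D_(0, Y) m (x, o), 0).
  apply: is_derive_pair.
  have p1 : is_derive o Y (fun y : 'rV[R]_n => (x, y)) (0, Y).
    exact: is_derive_pair.
    exact: (is_derive_comp_diff p1 (dm _ Ux1)).
  exact: is_derive_cst.
have dm2 : differentiable m (m (x, o), i x) by rewrite mxo; exact: dm.
have [_ ->] := is_derive_comp_diff g1 dm2.
by rewrite (derive_row_basis _ dm2) mxo.
Unshelve. all: by end_near. Qed.

Lemma Ad_continuous1 Y : {for 1%g, continuous (fun g : G => Ad g Y)}.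
Proof.
have A1 := chart1_atlas G; have D1 := chart1_dom1 G.
have c : {for 1%g, continuous ((fun x => Ad (psi x) Y) \o phi)}.
  apply: continuous_comp; first exact: chart_map_continuous.
  exact/differentiable_continuous/Ad_chart_diff.
apply: continuous_near_eq c.
by apply: filterS (chart_near A1 D1) => g dg; rewrite /= chart_inv_map.
Qed.

(** By the chain rule, the straight line in the chart that defines the bracket may be replaced by
    any curve with velocity [v]. *)
Lemma has_velocity_Ad (c : R -> G) v Y : has_velocity c v ->
  is_derive (0 : R) 1 (fun t : R => Ad (c t) Y) (lie_bracket G v Y).
Proof.
move=> hc; have [c0 _ dc] := hc.
have A1 := chart1_atlas G; have D1 := chart1_dom1 G.
have d : differentiable (fun x => Ad (psi x) Y) (phi (c 0)).
  by rewrite c0; exact: Ad_chart_diff.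
have := is_derive_comp_diff dc d; rewrite c0; apply: near_eq_is_derive.
apply: filterS (has_velocity_near_dom hc).
by move=> t ct; rewrite /= chart_inv_map.
Qed.

Lemma lie_bracket_linear v : linear (lie_bracket G v).
Proof.
move=> k X Y; have D Z := diff_derivable (v := v) (Ad_chart_diff Z).
rewrite /lie_bracket.
pose f Z x := Ad (psi x) Z.
change ('D_v (f (k *: X + Y)) o = k *: 'D_v (f X) o + 'D_v (f Y) o).
have -> : f (k *: X + Y) = k \*: f X + f Y.
  by apply/funext => x; rewrite /f (AdD _ (k *: X)) AdZ.
by rewrite (deriveD (derivableZ (k := k) (D X)) (D Y)) (deriveZ _ (D X)).
Qed.

Lemma is_derive_Ad_comp (g : G) (c : R -> 'rV[R]_n) (t : R) v : is_derive t 1 c v ->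
  is_derive t 1 (fun s : R => Ad g (c s)) (Ad g v).
Proof.
have [_ _ df] := diff1_conj g.
have AdE : Ad g = 'd (phi \o (fun x => g * x * g^-1)%g \o psi) o :> (_ -> _).
  by apply/funext => X; rewrite /Ad /tangent1 -deriveE.
move=> dc; have := is_derive_linear_comp (diff_continuous df) dc.
by rewrite -AdE.
Qed.

End AdRegularity.

(** * The exponential map and its relation to the adjoint representation *)

Section Exponential.
Context {R : realType} {n : nat} (G : lieGroupType R n).
Context (e : 'rV[R]_n -> G) (he : is_lie_exp e).
Local Notation phi := (cmap (chart1 G)).

Lemma exp_one_param X : one_param (fun t : R => e (t *: X)).
Proof. by move=> s t; have [_ + _] := he X; exact. Qed.

Lemma lie_exp0 : e 0 = 1%g.
Proof. by have := one_param0 (exp_one_param 0); rewrite scaler0. Qed.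

Lemma lie_expN X : e (- X) = (e X)^-1%g.
Proof. by have := one_paramN 1 (exp_one_param X); rewrite scaleN1r scale1r. Qed.

Lemma exp_scale_continuous X : continuous (fun t : R => e (t *: X)).
Proof.
move=> t; have [sm _ _] := he X.
have [c Ac ct] := lie_atlas_cover (e (t *: X)).
apply: (@smooth_map_continuous _ _ _ _ _ _ _ _ (Chart setT id id) c t sm) => //.
- exact: filterT.
- exact: lie_atlas_chart.
Qed.

Lemma exp_velocity X : has_velocity (fun t : R => e (t *: X)) X.
Proof.
have e0 : e (0 *: X) = 1%g by rewrite scale0r lie_exp0.
split => //; first exact: exp_scale_continuous.
have [sm _ dE] := he X.
have [|||||U [oU Uo _ /(_ 1%N)[dU _]]] :=
  @smooth_map_local _ _ _ _ _ _ _ _ (Chart setT id id) (chart1 G) 0 sm => //.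
- exact: chart1_atlas.
- by rewrite e0; exact: chart1_dom1.
by rewrite -[X in is_derive _ _ _ X]dE; apply/derivableP/diff_derivable/dU.
Qed.

(** Along the multiples of [X], both sides are one-parameter subgroups with velocity [Ad g X]. *)
Lemma exp_conj g X : (g * e X * g^-1)%g = e (Ad g X).
Proof.
rewrite -[X in e X]scale1r -[in RHS](scale1r (Ad g X)).
apply: (@one_param_unique _ _ _ (fun t => g * e (t *: X) * g^-1)%g
  (fun t => e (t *: Ad g X)) (Ad g X)).
- move=> s t; rewrite exp_one_param !mulgA; congr (_ * _ * _)%g.
  by rewrite mulgVK.
- exact: exp_one_param.
- exact: has_velocity_map (exp_velocity X) (diff1_conj g).
- exact: exp_velocity.
Qed.

(** The curve [f t = Ad (e (t X)) Y] solves [f' = c f], so each coordinate of [exp (- c s) f s] has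
    derivative zero. *)
Lemma Ad_exp_eigen X Y (c t : R) : lie_bracket G X Y = c *: Y ->
  Ad (e (t *: X)) Y = expR (c * t) *: Y.
Proof.
move=> XY; pose f t := Ad (e (t *: X)) Y.
have df (s : R) : is_derive s 1 f (c *: f s).
  apply: is_derive_line.
  (* The homomorphism property moves the derivative at [s] back to 0, where it is the bracket. *)
  have -> : (fun h : R => f (h *: 1 + s)) =
      (fun h => Ad (e (s *: X)) (f h)).
    apply/funext => h; rewrite /f -Ad_mul -exp_one_param.
    by rewrite [h%:A]mulr1 addrC.
  have -> : c *: f s = Ad (e (s *: X)) (lie_bracket G X Y).
    by rewrite XY AdZ.
  by apply: is_derive_Ad_comp; exact: has_velocity_Ad (exp_velocity X).
have f0 : f 0 = Y by rewrite /f scale0r lie_exp0 Ad1.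
apply/rowP => i; rewrite mxE -/(f t).
pose g (s : R) := f s ord0 i.
have dg (s : R) : is_derive s 1 g (c * g s).
  have [d1 d2] := df s.
  have dg : derivable g s 1 by exact: (derivable_mxP f s 1).1 d1 _ _.
  suff <- : 'D_1 g s = c * g s by exact: DeriveDef.
  by move/matrixP: (derive_mx d1) => /(_ ord0 i); rewrite d2 !mxE => <-.
pose h (s : R) := expR (- c * s) * g s.
have dh (s : R) : is_derive s 1 h 0.
  apply: is_derive_eq.
  rewrite /GRing.scale /= mulr1 !mulrN.
  by rewrite [g s * _]mulrCA [g s * c]mulrC subrr.
have : h t = h 0 by exact: is_derive_0_is_cst.
rewrite /h mulr0 expR0 mul1r {2}/g f0 => <-.
by rewrite mulrA -expRD mulNr subrr expR0 mul1r.
Qed.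

End Exponential.

(** * Limits at zero and linear maps on row vectors *)

Section LinearRow.
Context {R : realType} {n : nat}.

(** Meant for a parameter [tau = exp s], which takes positive values only, as [tau] tends to 0. *)
Lemma continuous_pos_const (V : normedModType R) (f : R -> V) (c : V) :
  {for (0 : R), continuous f} -> (forall t, 0 < t -> f t = c) -> f 0 = c.
Proof.
move=> cf fc.
have f1 : f t @[t --> (0 : R)^'+] --> f 0 by exact: cvg_at_right_filter.
have f2 : f t @[t --> (0 : R)^'+] --> c.
  apply: cvg_near_cst; near=> t; rewrite fc//.
exact: cvg_unique f1 f2.
Unshelve. all: by end_near. Qed.

Lemma linear_fun0 (V W : lmodType R) (f : V -> W) : linear f -> f 0 = 0.
Proof.
by move=> /(_ (-1) 0 0); rewrite scaler0 addr0 scaleN1r addNr.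
Qed.

Lemma linear_funD (V W : lmodType R) (f : V -> W) : linear f ->
  {morph f : v w / v + w}.
Proof. by move=> lf v w; have := lf 1 v w; rewrite !scale1r. Qed.

Lemma linear_funZ (V W : lmodType R) (f : V -> W) k : linear f ->
  {morph f : v / k *: v}.
Proof. by move=> lf v; have := lf k v 0; rewrite !addr0 (linear_fun0 lf) addr0. Qed.

Lemma linear_funN (V W : lmodType R) (f : V -> W) : linear f ->
  {morph f : v / - v}.
Proof. by move=> lf v; rewrite -scaleN1r linear_funZ// scaleN1r. Qed.

Lemma linear_row_le (f : 'rV[R]_n -> 'rV[R]_n) w : linear f ->
  `|f w| <= (\sum_(k < n) `|f (delta_mx ord0 k)|) * `|w|.
Proof.
move=> lf; pose fL := GRing.isLinear.Build _ _ _ _ f lf.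
pose L : {linear 'rV[R]_n -> 'rV[R]_n} := HB.pack f fL.
rewrite {1}[w]row_sum_delta -[f _]/(L _) linear_sum mulr_suml.
apply: le_trans (ler_norm_sum _ _ _) _; apply: ler_sum => k _.
rewrite linearZ normrZ mulrC; apply: ler_pM => //.
rewrite [leRHS]/Num.norm/= mx_normrE.
exact: (le_bigmax _ (fun ij : 'I_1 * 'I_n => `|w ij.1 ij.2|) (ord0, k)).
Qed.

End LinearRow.

(** * Gradings by eigenvalues -1, 0, 1 *)

Section Tripotent.
Context {K : realType} {V : lmodType K} (f : V -> V).

(* For [f] linear with [f^3 = f], the projections onto the eigenspaces. *)
Definition tri_plus v := 2^-1 *: (f (f v) + f v).
Definition tri_minus v := 2^-1 *: (f (f v) - f v).
Definition tri_zero v := v - f (f v).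

Lemma tri_sum v : v = tri_minus v + tri_zero v + tri_plus v.
Proof.
rewrite /tri_minus /tri_zero /tri_plus addrAC -scalerDr addrACA addNr addr0.
rewrite -mulr2n -[X in _ *: X]scaler_nat scalerA mulVf ?pnatr_eq0//.
by rewrite scale1r addrC subrK.
Qed.

Hypotheses (lf : linear f) (f3 : forall v, f (f (f v)) = f v).

Lemma tri_plus_linear : linear tri_plus.
Proof.
move=> k v w; rewrite /tri_plus !lf.
by rewrite !scalerDr !scalerA mulrC addrACA.
Qed.

Lemma tri_plus_pm x y : f x = x -> f y = - y -> tri_plus (x + y) = x.
Proof.
move=> hx hy; rewrite /tri_plus !(linear_funD lf) hx hy (linear_funN lf) hx hy opprK.
rewrite addrACA subrr addr0 -mulr2n -[X in _ *: X]scaler_nat.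
by rewrite scalerA mulVf ?pnatr_eq0// scale1r.
Qed.

Lemma tri_plusE v : f (tri_plus v) = tri_plus v.
Proof. by rewrite /tri_plus linear_funZ// linear_funD// f3 addrC. Qed.

Lemma tri_minusE v : f (tri_minus v) = - tri_minus v.
Proof.
rewrite /tri_minus (linear_funZ _ lf) (linear_funD lf) (linear_funN lf) f3.
by rewrite -scalerN opprB.
Qed.

Lemma tri_zeroE v : f (tri_zero v) = 0.
Proof. by rewrite /tri_zero linear_funD// linear_funN// f3 subrr. Qed.

End Tripotent.

(** * The exponential map on the pieces of a grading *)

Section Grading.
Context {R : realType} {n : nat} (G : lieGroupType R n).
Context (e : 'rV[R]_n -> G) (he : is_lie_exp e).

Lemma lie_bracketNl (Z v : 'rV[R]_n) : lie_bracket G (- Z) v = - lie_bracket G Z v.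
Proof.
exact: (linear_funN (derive_linear (Ad_chart_diff G v))).
Qed.

(** From left to right the linear differential equation is solved; from right to left its solution
    is differentiated at [s = 0]. The right side is stated in the group, where conjugation can be
    used. *)
Lemma exp_eigenP (Z v : 'rV[R]_n) (c : R) :
  lie_bracket G Z v = c *: v <->
  forall s : R, Ad (e (s *: Z)) v = expR (c * s) *: v.
Proof.
split=> [Zv s|H]; first exact: Ad_exp_eigen.
have [_ <-] := has_velocity_Ad v (exp_velocity he Z).
have -> : (fun s : R => Ad (e (s *: Z)) v) = (fun s => expR (c * s) *: v).
  exact/funext.
have d : is_derive (0 : R) 1 (fun s : R => expR (c * s)) c.
  apply: is_derive_eq.
  by rewrite mulr0 expR0 mul1r /GRing.scale/= mulr1.
have [d1 d2] := d.
rewrite deriveE; last by apply: differentiableZl; exact/derivable1_diffP.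
rewrite diffZl; last exact/derivable1_diffP.
by rewrite -deriveE ?d2//; exact/derivable1_diffP.
Qed.

Definition grade_one (Z v : 'rV[R]_n) : Prop := lie_bracket G Z v = v.

(* ad Z is diagonalizable with eigenvalues in {-1, 0, 1}. Since ad (- Z) = - ad Z,
   [grade_one (- Z)] is the eigenspace of ad Z for the eigenvalue -1. *)
Definition graded_by (Z : 'rV[R]_n) : Prop :=
  forall v, lie_bracket G Z (lie_bracket G Z (lie_bracket G Z v)) =
            lie_bracket G Z v.

Lemma graded_byN Z : graded_by Z -> graded_by (- Z).
Proof.
move=> hZ v; rewrite !lie_bracketNl.
have N := linear_funN (lie_bracket_linear G Z).
by rewrite !N opprK hZ.
Qed.

Context (Z : 'rV[R]_n) (hZ : graded_by Z).
Local Notation a s := (e (s *: Z)).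

Lemma grade_oneP v : grade_one Z v <-> forall s : R, Ad (a s) v = expR s *: v.
Proof.
rewrite /grade_one -{2}[v]scale1r exp_eigenP; split=> H s.
  by rewrite H mul1r.
by rewrite H mul1r.
Qed.

Lemma grade_oneZ k v : grade_one Z v -> grade_one Z (k *: v).
Proof.
move=> /grade_oneP vP; apply/grade_oneP => s.
by rewrite AdZ vP !scalerA mulrC.
Qed.

Lemma grade_oneD v w : grade_one Z v -> grade_one Z w -> grade_one Z (v + w).
Proof.
move=> /grade_oneP vP /grade_oneP wP; apply/grade_oneP => s.
by rewrite AdD vP wP scalerDr.
Qed.

Lemma grade_oneN v : grade_one Z v -> grade_one Z (- v).
Proof. by rewrite -scaleN1r; exact: grade_oneZ. Qed.

Lemma grade_one0 : grade_one Z 0.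
Proof. by apply/grade_oneP => s; rewrite Ad0 scaler0. Qed.

Local Notation proj_p := (tri_plus (lie_bracket G Z)).
Local Notation proj_m := (tri_minus (lie_bracket G Z)).
Local Notation proj_0 := (tri_zero (lie_bracket G Z)).

Lemma Ad_graded (s : R) v :
  Ad (a s) v = expR (- s) *: proj_m v + proj_0 v + expR s *: proj_p v.
Proof.
have lB := lie_bracket_linear G Z.
have m : lie_bracket G Z (proj_m v) = -1 *: proj_m v.
  by rewrite tri_minusE// scaleN1r.
have z : lie_bracket G Z (proj_0 v) = 0 *: proj_0 v.
  by rewrite tri_zeroE// scale0r.
have p : lie_bracket G Z (proj_p v) = 1 *: proj_p v.
  by rewrite tri_plusE// scale1r.
rewrite {1}[v](tri_sum (lie_bracket G Z)) 2!AdD.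
rewrite ((exp_eigenP _ _ _).1 m) ((exp_eigenP _ _ _).1 z) ((exp_eigenP _ _ _).1 p).
by rewrite mulN1r mul0r mul1r expR0 scale1r.
Qed.

Lemma grade_one_Ad_exp X v : grade_one Z X -> grade_one Z v -> Ad (e X) v = v.
Proof.
move=> hX hv; pose F t := Ad (e (t *: X)) v.
have F0 : F 0 = v by rewrite /F scale0r lie_exp0 // Ad1.
have cF : {for (0 : R), continuous F}.
  apply: (@continuous_comp _ _ _ (fun t : R => e (t *: X)) (fun g => Ad g v)).
    exact: exp_scale_continuous.
  by rewrite scale0r lie_exp0 //; exact: Ad_continuous1.
have cFt t : {for (0 : R), continuous (fun tau : R => F (tau * t))}.
  apply: (@continuous_comp _ _ _ (fun tau : R => tau * t) F).
    exact: mulrr_continuous.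
  by rewrite mul0r.
have cM : {for (0 : R), continuous (fun tau : R => tau * tau)}.
  by apply: continuousM; exact: cvg_id.
(* Both sides are [Ad (a s) (F t)]: on the left [a s] is moved past [e (t *: X)] by conjugation,
   which rescales [t] by [expR s]; on the right [F t] is split by the grading. *)
have FE t s : expR s *: F (expR s * t) =
    expR (- s) *: proj_m (F t) + proj_0 (F t) + expR s *: proj_p (F t).
  rewrite -Ad_graded /F -Ad_mul -[in RHS](mulgVK (a s) (a s * _)%g).
  rewrite exp_conj// Ad_mul (grade_oneP v).1//.
  have -> : Ad (a s) (t *: X) = (expR s * t) *: X.
    by rewrite AdZ (grade_oneP X).1// scalerA mulrC.
  by rewrite -(AdZ (e _)).
(* With [tau = exp s], FE reads
   [tau^2 F (tau t) = proj_m (F t) + tau proj_0 (F t) + tau^2 proj_p (F t)];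
   let tau tend to 0. *)
have Fm t : proj_m (F t) = 0.
  have : {for (0 : R), continuous (fun tau : R => (tau * tau) *: F (tau * t)
      - tau *: proj_0 (F t) - (tau * tau) *: proj_p (F t))}.
    apply: continuousB; last by apply: continuousZr_tmp; exact: cM.
    apply: continuousB; last by apply: continuousZr_tmp; exact: cvg_id.
    by apply: continuousZ; [exact: cM|exact: cFt].
  move=> /continuous_pos_const => /(_ (proj_m (F t))).
  rewrite !mul0r !scale0r !subr0 => H; apply/esym/H => tau tau0.
  have tau1 : tau * tau^-1 = 1 by rewrite mulfV// gt_eqF.
  have := FE t (ln tau); rewrite expRN lnK ?posrE//.
  move: (proj_m _) (proj_0 _) (proj_p _) => vm vz vp.
  rewrite -scalerA => ->.
  rewrite !scalerDr !scalerA tau1 scale1r.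
  by rewrite [LHS]addrAC !addrK.
(* With [proj_m (F t)] gone, [FE] reads [tau F (tau t) = proj_0 (F t) + tau proj_p (F t)], and [tau]
   tends to 0 again. *)
have Fz t : proj_0 (F t) = 0.
  have : {for (0 : R), continuous (fun tau : R => tau *: F (tau * t)
      - tau *: proj_p (F t))}.
    apply: continuousB; last by apply: continuousZr_tmp; exact: cvg_id.
    by apply: continuousZ; [exact: cvg_id|exact: cFt].
  move=> /continuous_pos_const => /(_ (proj_0 (F t))).
  rewrite !mul0r !scale0r !subr0 => H; apply/esym/H => tau tau0.
  have := FE t (ln tau); rewrite Fm scaler0 add0r lnK ?posrE// => ->.
  by rewrite addrK.
(* Only [proj_p (F 1)] is left, so [FE] gives [F tau = F 1] for all [tau > 0]; by continuity
   [F 0 = F 1]. *)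
have : {for (0 : R), continuous (fun tau : R => F (tau * 1))}.
  exact: cFt.
move=> /continuous_pos_const => /(_ (F 1)); rewrite mul0r F0 => H.
have <- : F 1 = Ad (e X) v by rewrite /F scale1r.
apply/esym/H => tau tau0.
have := FE 1 (ln tau); rewrite Fm Fz scaler0 !add0r lnK ?posrE//.
move=> /(scalerI _) ->; last by rewrite gt_eqF.
by rewrite {2}[F 1](tri_sum (lie_bracket G Z)) Fm Fz !add0r.
Qed.

Lemma grade_one_expC X Y : grade_one Z X -> grade_one Z Y ->
  (e X * e Y = e Y * e X)%g.
Proof.
move=> hX hY; rewrite -{2}(grade_one_Ad_exp hX hY) -exp_conj//.
by rewrite mulgVK.
Qed.

(** The factors commute, so their product is a one-parameter subgroup, with velocity [X + Y]. *)
Lemma grade_one_expD X Y : grade_one Z X -> grade_one Z Y ->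
  e (X + Y) = (e X * e Y)%g.
Proof.
move=> hX hY; rewrite -[X in e (X + _)]scale1r -[Y in e (_ + Y)]scale1r -scalerDr.
rewrite -[in RHS](scale1r X) -[in RHS](scale1r Y).
apply: (@one_param_unique _ _ _ (fun t => e (t *: (X + Y)))
  (fun t => e (t *: X) * e (t *: Y))%g (X + Y)).
- exact: exp_one_param.
- move=> s t; rewrite !exp_one_param// -!mulgA; congr (_ * _)%g.
  by rewrite !mulgA; congr (_ * _)%g; apply: grade_one_expC; exact: grade_oneZ.
- exact: exp_velocity.
- by apply: has_velocity_mul; exact: exp_velocity.
Qed.

(* Differentiate [e X a(s) (e X)^-1 = e ((1 - exp s) X) a(s)] at [s = 0]. *)
Lemma grade_one_Ad_grading X : grade_one Z X -> Ad (e X) Z = Z - X.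
Proof.
move=> hX.
have E (s : R) : (e X * a s * (e X)^-1)%g = (e ((1 - expR s) *: X) * a s)%g.
  rewrite -lie_expN// -mulgA -[(a s * e (- X))%g](mulgVK (a s)) exp_conj//.
  rewrite AdN (grade_oneP X).1// mulgA scalerBl scale1r grade_one_expD//.
  by apply: grade_oneN; exact: grade_oneZ.
apply: (@has_velocity_unique _ _ G (fun s => e X * a s * (e X)^-1)%g).
  exact: has_velocity_map (exp_velocity he Z) (diff1_conj (e X)).
have -> : (fun s => e X * a s * (e X)^-1)%g =
    (fun s => e ((1 - expR s) *: X) * a s)%g by exact/funext.
rewrite addrC -scaleN1r; apply: has_velocity_mul; last exact: exp_velocity.
apply: (@has_velocity_reparam _ _ _ (fun t => e (t *: X)) X (fun s => 1 - expR s)).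
- exact: exp_velocity.
- by rewrite expR0 subrr.
- apply: is_derive_eq.
  by rewrite expR0 add0r mul1r.
Qed.

Lemma stab_conj_exp (h : G) (s : R) : Ad h Z = Z -> (h * a s * h^-1)%g = a s.
Proof. by move=> hh; rewrite exp_conj// AdZ hh. Qed.

(** An element fixing [Z] commutes with every [a s], hence [Ad h] preserves the eigenspaces of
    [Ad (a s)]. *)
Lemma stab_grade_one (h : G) v : Ad h Z = Z -> grade_one Z v -> grade_one Z (Ad h v).
Proof.
move=> hh hv; apply/grade_oneP => s; rewrite -Ad_mul -{1}(stab_conj_exp s hh).
by rewrite mulgVK Ad_mul (grade_oneP v).1// AdZ.
Qed.

End Grading.

(** * Coordinates on the open cell near the identity *)

Section BigCell.
Context {R : realType} {n : nat} (G : lieGroupType R n).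
Context (e : 'rV[R]_n -> G) (he : is_lie_exp e).
Context (Z : 'rV[R]_n) (hZ : graded_by G Z).

Lemma row_expansion (U : 'M[R]_n) (v : 'rV[R]_n) : (v <= U)%MS ->
  \sum_i (v *m pinvmx U) ord0 i *: row i U = v.
Proof. by move=> vU; rewrite -mulmx_sum_row mulmxKpV. Qed.

(* The sum is the projection of [v] onto [U]; exp itself is only known to be
   smooth along rays. *)
Lemma exp_grade_one_continuous (U : 'M[R]_n) :
  (forall v, (v <= U)%MS <-> grade_one G Z v) ->
  continuous (fun v : 'rV[R]_n => e (\sum_i (v *m pinvmx U) ord0 i *: row i U)).
Proof.
move=> hU v.
have rowU i c : grade_one G Z (c *: row i U).
  by apply: (grade_oneZ he); apply/hU; exact: row_sub.
(* Induction on the list of rows: exp turns the sum into a product of one-parameter factors, each of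
   them continuous. The second conjunct is what [grade_one_expD] asks of the partial sums. *)
suff H (r : seq 'I_n) : {for v, continuous (fun v : 'rV[R]_n =>
    e (\sum_(i <- r) (v *m pinvmx U) ord0 i *: row i U))} /\ (forall w : 'rV[R]_n,
    grade_one G Z (\sum_(i <- r) (w *m pinvmx U) ord0 i *: row i U)).
  exact: (H _).1.
elim: r => [|i r [IH1 IH2]].
  split; last by move=> w; rewrite big_nil; exact: grade_one0.
  have -> : (fun v : 'rV[R]_n =>
      e (\sum_(i <- [::]) (v *m pinvmx U) ord0 i *: row i U))
      = fun=> e 0 by apply/funext => w; rewrite big_nil.
  exact: cst_continuous.
split; last by move=> w; rewrite big_cons; apply: (grade_oneD he).
have -> : (fun v : 'rV[R]_n =>
      e (\sum_(i <- i :: r) (v *m pinvmx U) ord0 i *: row i U))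
    = fun v => (e ((v *m pinvmx U) ord0 i *: row i U) *
         e (\sum_(i <- r) (v *m pinvmx U) ord0 i *: row i U))%g.
  by apply/funext => w; rewrite big_cons (grade_one_expD he hZ).
apply: lie_mul_continuous_at => //.
apply: (@continuous_comp _ _ _ (fun v : 'rV[R]_n => (v *m pinvmx U) ord0 i)
  (fun t : R => e (t *: row i U))); last exact: exp_scale_continuous.
have -> : (fun v : 'rV[R]_n => (v *m pinvmx U) ord0 i) =
    \sum_k (fun v : 'rV[R]_n => v ord0 k * pinvmx U k i).
  by apply/funext => w; rewrite mxE fct_sumE.
apply: differentiable_continuous; apply: differentiable_sum => k.
by apply: differentiableM => //; exact: differentiable_coord.
Qed.

Lemma Ad_sub_small (eps : R) : 0 < eps ->
  \forall g \near (1%g : G), forall w, `|w - Ad (g^-1)%g w| <= eps * `|w|.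
Proof.
move=> eps0.
have c k : {for (1%g : G), continuous
    (fun g : G => delta_mx ord0 k - Ad (g^-1)%g (delta_mx ord0 k) : 'rV[R]_n)}.
  apply: continuousB; first exact: cst_continuous.
  apply: (@continuous_comp _ _ _ (fun g : G => (g^-1)%g : G)
    (fun g => Ad g (delta_mx ord0 k))).
    exact: lie_inv_continuous.
  by rewrite invg1; exact: Ad_continuous1.
(* There are [n] basis vectors to sum over; the successor keeps the denominator nonzero when
   [n = 0]. *)
have eps1 : 0 < eps / n.+1%:R by rewrite divr_gt0.
have : \forall g \near (1%g : G), forall k,
    `|delta_mx ord0 k - Ad (g^-1)%g (delta_mx ord0 k) : 'rV[R]_n| <= eps / n.+1%:R.
  apply: filter_forall => k; have := c k.
  rewrite /prop_for /continuous_at invg1 Ad1 subrr => /cvgr0Pnorm_le.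
  exact.
apply: filterS => g ge w.
have lin : linear (fun w => w - Ad (g^-1)%g w).
  by move=> k x y; rewrite (AdD _ (k *: x)) (AdZ _ k) scalerBr addrACA opprD.
apply: le_trans (linear_row_le w lin) _.
apply: ler_wpM2r => //.
apply: (@le_trans _ _ (\sum_(k < n) eps / n.+1%:R)); first exact: ler_sum.
rewrite sumr_const card_ord -[leLHS]mulr_natr -mulrA ler_piMr ?ltW//.
by rewrite mulrC ltr_pdivrMr// mul1r ltr_nat.
Qed.

(** Complementarity in the form that estimates need: through the norm of [P], a bound on [x + y]
    bounds [x]. *)
Lemma grade_one_unique_proj : exists2 P : 'rV[R]_n -> 'rV[R]_n, linear P &
  forall x y, grade_one G Z x -> grade_one G (- Z) y -> P (x + y) = x.
Proof.
have lB := lie_bracket_linear G Z.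
exists (tri_plus (lie_bracket G Z)); first exact: tri_plus_linear.
move=> x y hx; rewrite /grade_one lie_bracketNl// => /(canRL opprK) hy.
exact: tri_plus_pm.
Qed.

(** Put [w = Z - X] and [u = Y - X]. Then [u = w - Ad (p^-1) w] is at most [d |w|], while
    [|w| <= |Z| + C |u|]; for small [d] the term in [|u|] is absorbed on the left, and
    [|Y| <= (1 + C) |u|]. *)
Lemma bigcell_coord_small (eps : R) : 0 < eps ->
  \forall p \near (1%g : G), forall (X Y : 'rV[R]_n) (k : G),
    grade_one G Z X -> Ad k Z = Z -> grade_one G (- Z) Y ->
    p = (e X * k * e Y)%g -> `|Y| <= eps.
Proof.
move=> eps0; have [P lP hP] := grade_one_unique_proj.
pose C := \sum_(k < n) `|P (delta_mx ord0 k)|.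
have C0 : 0 <= C by exact: sumr_ge0.
have C1 : 0 < C + 1 by rewrite ltr_wpDl.
have Z1 : 0 < `|Z| + 1 by rewrite ltr_wpDl.
(* The first bound gives [d C <= 1/2], hence [|u| <= 2 d |Z|]; the second gives
   [2 (1 + C) d |Z| <= eps]. Adding 1 to [C] and to [|Z|] keeps the denominators positive. *)
pose d := Num.min (2 * (C + 1))^-1 (eps / (2 * (C + 1) * (`|Z| + 1))).
have d0 : 0 < d by rewrite lt_min invr_gt0 divr_gt0 ?mulr_gt0.
have d1 : d * (2 * (C + 1)) <= 1.
  by rewrite -ler_pdivlMr ?mulr_gt0// mul1r ge_min lexx.
have d2 : d * (2 * (C + 1) * (`|Z| + 1)) <= eps.
  by rewrite -ler_pdivlMr ?mulr_gt0// ge_min lexx orbT.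
apply: filterS (Ad_sub_small d0) => p hp X Y k hX hk hY pE.
have AX : Ad (e (- X)) (Z - X) = Z.
  by rewrite -(grade_one_Ad_grading he hZ hX) lie_expN// AdK.
have Ak : Ad (k^-1)%g Z = Z by rewrite -{1}hk AdK.
(* The previous lemma for the opposite grading [- Z] and the vector [- Y], up to a sign. *)
have AY : Ad (e (- Y)) Z = Z - Y.
  have := grade_one_Ad_grading he (graded_byN hZ) (grade_oneN he hY).
  by rewrite AdN opprK => /(congr1 -%R); rewrite opprK opprD opprK.
have pw : Ad (p^-1)%g (Z - X) = Z - Y.
  have -> : (p^-1)%g = (e (- Y) * (k^-1 * e (- X)))%g.
    by rewrite pE !invgM !(lie_expN he).
  by rewrite Ad_mul Ad_mul AX Ak AY.
have := hp (Z - X); rewrite pw.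
have -> : Z - X - (Z - Y) = - X + Y by rewrite opprB addrC addrA subrK addrC.
set u := - X + Y => hu.
have hXu : `|X| <= C * `|u|.
  have Pu : P u = - X by apply: hP => //; exact: (grade_oneN he).
  by rewrite -normrN -Pu; exact: linear_row_le.
have hw : `|Z - X| <= `|Z| + `|X| by exact: ler_normB.
have hYu : `|Y| <= `|u| + `|X|.
  by rewrite (_ : Y = u + X) ?ler_normD// /u addrAC addNr add0r.
have := normr_ge0 u; have := normr_ge0 X; have := normr_ge0 Z.
move: hu hXu hw hYu d1 d2 d0 C0.
move: `|u| `|X| `|Y| `|Z| `|Z - X| => u' x y z w hu hx hw hy d1 d2 d0 C0 z0 x0 u0.
have h1 : u' <= 2 * d * z.
  have h : d * w <= d * (z + C * u') by apply: ler_wpM2l; [exact: ltW|lra].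
  nra.
have h2 : y <= (1 + C) * u' by lra.
have h3 : (1 + C) * u' <= (1 + C) * (2 * d * z) by apply: ler_wpM2l => //; lra.
nra.
Qed.

End BigCell.

(** * Para-Hermitian symmetric spaces *)

Section ComplexPower.
Context {R : realType}.
Implicit Types (a b : R) (l : R[i]).

Lemma abs_cpowM a b l : a != 0 -> b != 0 ->
  abs_cpow (a * b) l = abs_cpow a l * abs_cpow b l.
Proof.
move=> a0 b0; rewrite /abs_cpow normrM lnM ?posrE ?normr_gt0//.
rewrite !mulrDr expRD cosD sinD.
move: (expR _) (expR _) (cos _) (cos _) (sin _) (sin _) => x y c c' s s'.
apply/eqP; rewrite eq_complex /=; apply/andP; split; apply/eqP; ring.
Qed.

Lemma abs_cpow1 l : abs_cpow (1 : R) l = 1.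
Proof.
rewrite /abs_cpow normr1 ln1 !mulr0 expR0 cos0 sin0.
by apply/eqP; rewrite eq_complex /= !(mul0r, mulr0, mulr1, subr0, addr0) !eqxx.
Qed.

Lemma abs_cpowV a l : a != 0 -> abs_cpow a^-1 l = (abs_cpow a l)^-1.
Proof.
move=> a0; have h : abs_cpow a l * abs_cpow a^-1 l = 1.
  by rewrite -abs_cpowM ?invr_eq0// mulfV// abs_cpow1.
have n0 : abs_cpow a l != 0.
  by apply/eqP => h0; move/eqP: h; rewrite h0 mul0r eq_sym oner_eq0.
by apply: (mulfI n0); rewrite h mulfV.
Qed.

Lemma abs_cpow_neq0 a l : a != 0 -> abs_cpow a l != 0.
Proof.
move=> a0; apply/eqP => h0.
have : abs_cpow (a * a^-1) l = 0 by rewrite abs_cpowM ?invr_eq0// h0 mul0r.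
by rewrite mulfV// abs_cpow1 => /eqP; rewrite oner_eq0.
Qed.

(** This is the normalization that turns [omega] into [Phi]: if [b = N^(-k)], then
    [|b|^(- l / k) = |N|^l]. *)
Lemma abs_cpow_exp_inv a l (k : nat) : (0 < k)%N -> a != 0 ->
  abs_cpow (a ^+ k)^-1 (- l / k%:R) = abs_cpow a l.
Proof.
move=> k0 a0; rewrite /abs_cpow normfV normrX lnV ?posrE ?exprn_gt0 ?normr_gt0//.
rewrite lnXn ?normr_gt0//; move: (ln _) => t.
have kl : (- l / k%:R) *+ k = - l.
  by rewrite -mulr_natr divfK// pnatr_eq0 -lt0n.
(* The logarithm of [a ^+ k] supplies a factor [k], so only the [k]-th multiple of the quotient by
   [k] has to be split into real and imaginary parts. *)
have key (u w : R) : u *+ k = - w -> u * - (t *+ k) = w * t.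
  by move=> E; rewrite mulrN mulrnAr -mulrnAl E mulNr opprK.
have ReMn (z : R[i]) m : complex.Re (z *+ m) = complex.Re z *+ m.
  by elim: m => [//|m IH]; rewrite !mulrS -IH; case: z {IH} (z *+ m) => ? ? [].
have ImMn (z : R[i]) m : complex.Im (z *+ m) = complex.Im z *+ m.
  by elim: m => [//|m IH]; rewrite !mulrS -IH; case: z {IH} (z *+ m) => ? ? [].
rewrite (key _ (complex.Re l)); last by rewrite -ReMn kl; case: (l).
by rewrite (key _ (complex.Im l))// -ImMn kl; case: (l).
Qed.

End ComplexPower.

(** * The grading by [Z0] and the character of H *)

Section ParaHermitianFacts.
Context {R : realType} {n : nat} {G : lieGroupType R n}.
Context (S : @symmetric_data R n G) (hS : para_hermitian S).
Local Notation e := (sd_exp S).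
Local Notation sigma := (sd_sigma S).
Local Notation H := (sd_H S).
Local Notation Z0 := (sd_Z0 S).
Local Notation theta := (tangent1 (sd_sigma S)).
Let he : is_lie_exp e := ph_exp hS.

Lemma mul_lin1 (f : 'rV[R]_n -> 'rV[R]_n) v : linear f -> v *m lin1_mx f = f v.
Proof.
move=> lf; pose fL := GRing.isLinear.Build _ _ _ _ f lf.
pose L : {linear 'rV[R]_n -> 'rV[R]_n} := HB.pack f fL.
exact: (mul_rV_lin1 L).
Qed.

Lemma sigma_diff1 : diff1 sigma.
Proof.
have [sm hm _ _] := ph_involution hS.
have s1 : sigma 1%g = 1%g.
  by apply: (@mulgI _ (sigma 1%g)); rewrite -hm !mulg1.
split => //; first exact: smooth_lie_map_continuous.
have A1 := chart1_atlas G; have D1 := chart1_dom1 G.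
have D1' : cdom (chart1 G) (sigma 1%g) by rewrite s1.
have [|U [oU Uo _ /(_ 1%N)[dU _]]] := smooth_map_local sm A1 A1 D1 D1'.
  exact: chart_inv_map.
exact: dU.
Qed.

Lemma sigma_tangent_linear : linear theta.
Proof. exact/tangent1_linear/sigma_diff1. Qed.

Lemma sigma_tangentK v : theta (theta v) = v.
Proof.
have [_ <-] := diff1_comp sigma_diff1 sigma_diff1.
have [_ _ sK _] := ph_involution hS.
rewrite (_ : sigma \o sigma = id) ?tangent1_id//.
by apply/funext => x; exact: sK.
Qed.

Lemma lie_hP v : (v <= lie_h S)%MS <-> theta v = v.
Proof.
have E := mul_lin1 v sigma_tangent_linear.
by split=> [/eigenspaceP|h]; [rewrite E scale1r|
  apply/eigenspaceP; rewrite E scale1r].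
Qed.

Lemma lie_qP v : (v <= lie_q S)%MS <-> theta v = - v.
Proof.
have E := mul_lin1 v sigma_tangent_linear.
by split=> [/eigenspaceP|h]; [rewrite E scaleN1r|
  apply/eigenspaceP; rewrite E scaleN1r].
Qed.

Lemma eigen_ad_Z0P (c : R) (v : 'rV[R]_n) :
  (v <= eigenspace (ad_Z0 S) c)%MS <-> lie_bracket G Z0 v = c *: v.
Proof.
have E := mul_lin1 v (lie_bracket_linear G Z0).
by split=> [/eigenspaceP|h]; [rewrite E|apply/eigenspaceP; rewrite E].
Qed.

(** First split [v] into its [theta]-even and [theta]-odd halves. The even half lies in h, where
    [Z0] is central; the odd half splits by [ph_diag]. *)
Lemma para_decomp v : exists x y z,
  [/\ v = x + y + z, lie_bracket G Z0 y = 0, (x <= qminus S)%MS & (z <= qplus S)%MS].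
Proof.
have lt := sigma_tangent_linear.
pose y := 2^-1 *: (v + theta v); pose q := 2^-1 *: (v - theta v).
have hy : (y <= lie_h S)%MS.
  apply/lie_hP; rewrite /y (linear_funZ _ lt) (linear_funD lt) sigma_tangentK.
  by rewrite addrC.
have hq : (q <= lie_q S)%MS.
  apply/lie_qP; rewrite /q (linear_funZ _ lt) (linear_funD lt) (linear_funN lt).
  by rewrite sigma_tangentK -scalerN opprB.
have vE : v = y + q.
  rewrite /y /q -scalerDr addrACA subrr addr0 -mulr2n -[X in _ *: X]scaler_nat.
  by rewrite scalerA mulVf ?pnatr_eq0// scale1r.
have := hq; rewrite -(ph_diag hS) => /sub_addsmxP[[u1 u2] /= qE].
exists (u1 *m qminus S), y, (u2 *m qplus S); split.
- by rewrite {1}vE qE addrA [y + _]addrC.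
- have [_ /(_ (ex_intro _ 1 _))] := ph_center hS Z0.
  by rewrite scale1r => /(_ erefl)[_]; exact.
- exact: submxMl.
- exact: submxMl.
Qed.

Lemma qplus_eigen v : (v <= qplus S)%MS -> lie_bracket G Z0 v = v.
Proof. by rewrite sub_capmx => /andP[_ /eigen_ad_Z0P]; rewrite scale1r. Qed.

Lemma qminus_eigen v : (v <= qminus S)%MS -> lie_bracket G Z0 v = - v.
Proof. by rewrite sub_capmx => /andP[_ /eigen_ad_Z0P]; rewrite scaleN1r. Qed.

Lemma para_graded : graded_by G Z0.
Proof.
move=> v; have [x [y [z [-> hy hx hz]]]] := para_decomp v.
have lB := lie_bracket_linear G Z0.
have bx := qminus_eigen hx; have bz := qplus_eigen hz.
move: (lie_bracket G Z0) lB hy bx bz => f lf fy fx fz.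
have f0 := linear_fun0 lf.
by rewrite !(linear_funD lf) !(fx, fy, fz, f0, linear_funN lf, opprK).
Qed.

Lemma para_gradedN : graded_by G (- Z0).
Proof. exact: graded_byN para_graded. Qed.

Lemma eq_opp_eq0 (w : 'rV[R]_n) : w = - w -> w = 0.
Proof.
move=> /eqP; rewrite -addr_eq0 -mulr2n -scaler_nat scaler_eq0 pnatr_eq0 /=.
by move/eqP.
Qed.

(** For an eigenvector [x + y + z] of eigenvalue 1, comparing components leaves [- x = x + y]; a
    second application of [ad Z0] gives [x = - x], so that [x] and then [y] vanish. *)
Lemma qplusP v : (v <= qplus S)%MS <-> grade_one G Z0 v.
Proof.
split; first exact: qplus_eigen.
rewrite /grade_one; have [x [y [z [-> hy hx hz]]]] := para_decomp v.
have lB := lie_bracket_linear G Z0.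
have bx := qminus_eigen hx; have bz := qplus_eigen hz.
move: (lie_bracket G Z0) lB hy bx bz => f lf fy fx fz.
rewrite !(linear_funD lf) fx fy fz addr0 => /addIr E.
have := congr1 f E; rewrite (linear_funN lf) (linear_funD lf) fx fy addr0 opprK.
move=> /eq_opp_eq0 x0; move: E; rewrite x0 oppr0 add0r => <-.
by rewrite add0r.
Qed.

Lemma qminusP v : (v <= qminus S)%MS <-> grade_one G (- Z0) v.
Proof.
rewrite /grade_one lie_bracketNl; split.
  by move=> /qminus_eigen ->; rewrite opprK.
have [x [y [z [-> hy hx hz]]]] := para_decomp v.
have lB := lie_bracket_linear G Z0.
have bx := qminus_eigen hx; have bz := qplus_eigen hz.
move: (lie_bracket G Z0) lB hy bx bz => f lf fy fx fz.
rewrite !(linear_funD lf) fx fy fz addr0 opprD opprK -addrA => /addrI E.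
have := congr1 f E; rewrite (linear_funN lf) (linear_funD lf) fz fy add0r.
move=> /esym /eq_opp_eq0 z0; move: E; rewrite z0 oppr0 addr0 => <-.
by rewrite !addr0.
Qed.

Lemma stabP h : H h <-> Ad h Z0 = Z0.
Proof. by rewrite (ph_stabilizer hS). Qed.

Lemma stabNP h : H h <-> Ad h (- Z0) = - Z0.
Proof. by rewrite stabP AdN; split=> [->//|/oppr_inj]. Qed.

Lemma sub1H : H 1%g. Proof. by have [] := ph_subgroup hS. Qed.

Lemma subMH x y : H x -> H y -> H (x * y)%g.
Proof. by have [_ + _] := ph_subgroup hS; exact. Qed.

Lemma subVH x : H x -> H (x^-1)%g.
Proof. by have [_ _ +] := ph_subgroup hS; exact. Qed.

Lemma Ad_qplus h v : H h -> (v <= qplus S)%MS -> (Ad h v <= qplus S)%MS.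
Proof. by move=> /stabP hh /qplusP hv; apply/qplusP; exact: stab_grade_one. Qed.

Lemma Ad_qminus h v : H h -> (v <= qminus S)%MS -> (Ad h v <= qminus S)%MS.
Proof.
by move=> /stabNP hh /qminusP hv; apply/qminusP; exact: (stab_grade_one he).
Qed.

Lemma exp_qplusD x y : (x <= qplus S)%MS -> (y <= qplus S)%MS ->
  e (x + y) = (e x * e y)%g.
Proof. by move=> /qplusP hx /qplusP hy; exact: (grade_one_expD he para_graded). Qed.

Lemma exp_qminusD x y : (x <= qminus S)%MS -> (y <= qminus S)%MS ->
  e (x + y) = (e x * e y)%g.
Proof.
by move=> /qminusP hx /qminusP hy; exact: (grade_one_expD he para_gradedN).
Qed.

Lemma stablemx_Ad_qplus h : H h -> stablemx (qplus S) (lin1_mx (Ad h)).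
Proof.
move=> hh; apply/row_subP => i; rewrite row_mul mul_lin1; last exact: Ad_linear.
by apply: Ad_qplus => //; exact: row_sub.
Qed.

Lemma b_charM h k : H h -> H k -> b_char S (h * k)%g = b_char S h * b_char S k.
Proof.
(* Matrices act on rows from the right, so the matrix of [Ad (h * k)] is that of [Ad k] times that
   of [Ad h]. *)
move=> hh hk; rewrite /b_char mulrC -det_mulmx -conjmxM.
- congr (\det (conjmx _ _)); apply/row_matrixP => i; rewrite !rowE mulmxA.
  by rewrite !mul_lin1 ?Ad_mul//; exact: Ad_linear.
- by rewrite inE stablemx_row_base; exact: stablemx_Ad_qplus.
- by rewrite inE stablemx_row_base; exact: stablemx_Ad_qplus.
Qed.

Lemma b_char1 : b_char S (1%g : G) = 1.
Proof.
rewrite /b_char (_ : lin1_mx _ = 1%:M) ?conjmx_scalar ?row_base_free ?det1//.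
apply/row_matrixP => i; rewrite !rowE mul_lin1 ?Ad1 ?mulmx1//.
exact: Ad_linear.
Qed.

Lemma b_char_neq0 h : H h -> b_char S h != 0.
Proof.
move=> hh; have := b_charM hh (subVH hh); rewrite mulgV b_char1.
by move=> /esym/eqP; apply: contraTneq => ->; rewrite mul0r eq_sym oner_eq0.
Qed.

Lemma omegaM kappa l h k : H h -> H k ->
  omega S kappa l (h * k)%g = omega S kappa l h * omega S kappa l k.
Proof. by move=> hh hk; rewrite /omega b_charM// abs_cpowM// b_char_neq0. Qed.

Lemma b_charV h : H h -> b_char S (h^-1)%g = (b_char S h)^-1.
Proof.
move=> hh; have := b_charM hh (subVH hh); rewrite mulgV b_char1.
move: (b_char S h) (b_char S _) (b_char_neq0 hh) => x y x0 xy.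
by apply: (mulfI x0); rewrite -xy mulfV.
Qed.

Lemma omegaV kappa l h : H h -> omega S kappa l (h^-1)%g = (omega S kappa l h)^-1.
Proof. by move=> hh; rewrite /omega b_charV// abs_cpowV// b_char_neq0. Qed.

Lemma omega_neq0 kappa l h : H h -> omega S kappa l h != 0.
Proof. by move=> hh; apply: abs_cpow_neq0; exact: b_char_neq0. Qed.

End ParaHermitianFacts.

(** * The representation in horospherical coordinates *)

Section Formula.
Context {R : realType} {n : nat} {G : lieGroupType R n}.
Context (S : @symmetric_data R n G) (hS : para_hermitian S).
Local Notation e := (sd_exp S).
Local Notation H := (sd_H S).
Let he : is_lie_exp e := ph_exp hS.

Lemma translate_translate (a b c d : G) y :
  translate a (translate c y d) b = translate (a * c)%g y (d * b)%g.
Proof.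
apply/seteqP; split=> x /=.
  by move=> [_ [z yz <-] <-]; exists z => //; rewrite !mulgA.
by move=> [z yz <-]; exists (c * z * d)%g; [exists z|rewrite !mulgA].
Qed.

Lemma QmQp_mull X (a b : G) : (X <= qminus S)%MS ->
  translate (a * e X)%g (QmQp S) b = translate a (QmQp S) b.
Proof.
move=> hX; apply/seteqP; split=> _ [_ [_ [x xm <-] [q qp <-]] <-].
  exists (e (X + x) * q)%g; last by rewrite (exp_qminusD hS)// !mulgA.
  by exists (e (X + x)); [exists (X + x) => //=; exact: addmx_sub|exists q].
exists (e (- X + x) * q)%g; last first.
  rewrite (exp_qminusD hS) ?eqmx_opp// lie_expN// !mulgA; congr (_ * _ * _ * _)%g.
  by rewrite mulgK.
exists (e (- X + x)); last by exists q.
by exists (- X + x) => //=; apply: addmx_sub => //; rewrite eqmx_opp.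
Qed.

Lemma QmQp_mulr Y (a b : G) : (Y <= qplus S)%MS ->
  translate a (QmQp S) (e Y * b)%g = translate a (QmQp S) b.
Proof.
move=> hY; apply/seteqP; split=> _ [_ [p pm [_ [y yp <-] <-]] <-].
  exists (p * e (y + Y))%g; last by rewrite (exp_qplusD hS)// !mulgA.
  exists p => //; exists (e (y + Y)) => //.
  by exists (y + Y) => //=; exact: addmx_sub.
exists (p * e (y - Y))%g; last first.
  rewrite (exp_qplusD hS) ?eqmx_opp// lie_expN// !mulgA; congr (_ * _)%g.
  by rewrite mulgVK.
exists p => //; exists (e (y - Y)) => //.
by exists (y - Y) => //=; apply: addmx_sub => //; rewrite eqmx_opp.
Qed.

Lemma QmQp_conj h (a b : G) : H h ->
  translate (a * h)%g (QmQp S) b = translate a (QmQp S) (h * b)%g.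
Proof.
move=> hh; apply/seteqP; split=> _ [_ [_ [x xm <-] [_ [y yp <-] <-]] <-].
  exists (e (Ad h x) * e (Ad h y))%g.
    exists (e (Ad h x)); first by exists (Ad h x) => //; exact: Ad_qminus.
    by exists (e (Ad h y)) => //; exists (Ad h y) => //; exact: Ad_qplus.
  by rewrite -!exp_conj// !mulgA !mulgVK.
have hV := subVH hS hh.
exists (e (Ad (h^-1)%g x) * e (Ad (h^-1)%g y))%g.
  exists (e (Ad (h^-1)%g x)).
    by exists (Ad (h^-1)%g x) => //; exact: Ad_qminus.
  by exists (e (Ad (h^-1)%g y)) => //; exists (Ad (h^-1)%g y) => //; exact: Ad_qplus.
by rewrite -!exp_conj// invgK !mulgA !mulgK.
Qed.

Context (kappa : nat) (hkappa : (0 < kappa)%N) (N : pair_poly S).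
Hypothesis hN : forall (xi eta X Y : 'rV[R]_n) (h : G),
     (xi <= qminus S)%MS -> (eta <= qplus S)%MS ->
     horo_decomp S xi eta X Y h ->
     b_char S h = (pair_eval N xi eta ^+ kappa)^-1.
Context (lambda : R[i]).

Lemma omega_horo xi eta X Y h : (xi <= qminus S)%MS -> (eta <= qplus S)%MS ->
  horo_decomp S xi eta X Y h ->
  omega S kappa lambda h = Phi N lambda xi eta.
Proof.
move=> hxi heta hd; have [_ _ hh _] := hd.
have bE := hN hxi heta hd; rewrite /omega bE /Phi abs_cpow_exp_inv//.
(* [N] does not vanish at [(xi, eta)]: otherwise, [kappa] being positive and the inverse of 0 being
   0, the character would vanish at [h]. *)
have := b_char_neq0 hS hh; rewrite bE invr_eq0.
by apply: contraNneq => ->; rewrite expr0n eqn0Ngt hkappa.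
Qed.

Lemma horo_point xi eta X Y h : horo_decomp S xi eta X Y h ->
  (e Y * e xi)%g = (e X * h * e eta)%g.
Proof.
move=> [_ _ _ E].
have -> : e xi = (e (- Y) * e X * h * e eta)%g by rewrite -E (lie_expN he) mulgVK.
by rewrite (lie_expN he) !mulgA mulgV mul1g.
Qed.

Lemma R_rep_formula (g1 g2 : G) f : D_space S kappa lambda f ->
  forall (xi eta xi' eta' : 'rV[R]_n) (h2 h1 : G) (x x' : set G),
    (xi <= qminus S)%MS -> (eta <= qplus S)%MS ->
    qminus_act S xi g2 h2 xi' -> qplus_act S eta g1 h1 eta' ->
    has_horo_coord S x xi eta -> has_horo_coord S x' xi' eta' ->
    R_rep g1 g2 f x = Phi N lambda xi' eta' / Phi N lambda xi eta
      * omega S kappa lambda h2 * omega S kappa lambda (h1^-1)%g * f x'.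
Proof.
move=> [_ _ hf] xi eta xi' eta' h2 h1 x x' hxi heta
  [hh2 hxi' [Y2 hY2 E2]] [hh1 heta' [X1 hX1 E1]] [X [Y [h [hd ->]]]]
  [X' [Y' [h' [hd' ->]]]].
have [hX hY hh _] := hd; have [hX' hY' hh' _] := hd'.
have s1 := horo_point hd; have s1' := horo_point hd'.
(* The point [s'] is written [e X' h' e eta'] in the left factor and [e Y' e xi'] in the right one;
   then [X'] and [Y'] are absorbed by the coset. *)
have xE : f (Defs.point S (e Y' * e xi')%g) =
    omega S kappa lambda (h'^-1)%g * f (double_coset S (e eta') (e xi')).
  rewrite /Defs.point /double_coset {1}s1' QmQp_mulr// !invgM.
  rewrite -(lie_expN he X') mulgA.
  by rewrite QmQp_mull ?eqmx_opp// hf//; exact: subVH.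
have hV := subVH hS.
(* Likewise [s g1 = e X h e X1 h1 e eta'] and [s g2 = e Y e Y2 h2 e xi']; conjugation by [h] brings
   [e (- X1)] next to the coset, where it is absorbed. *)
have yE : R_rep g1 g2 f (Defs.point S (e Y * e xi)%g) =
    omega S kappa lambda (h1^-1 * h^-1 * h2)%g * f (double_coset S (e eta') (e xi')).
  rewrite /R_rep /Defs.point /double_coset translate_translate.
  have -> : (e Y * e xi * g2)%g = (e Y * (e Y2 * (h2 * e xi')))%g.
    by rewrite -mulgA E2 !mulgA.
  have -> : (g1^-1 * (e Y * e xi)^-1)%g =
      ((e eta')^-1 * h1^-1 * h^-1 * e (Ad h (- X1)) * e (- X))%g.
    rewrite -invgM s1 -[in LHS]mulgA E1 -exp_conj// !invgM !(lie_expN he) !mulgA.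
    by rewrite mulgVK.
  have hXN : (- X <= qminus S)%MS by rewrite eqmx_opp.
  have hX1N : (Ad h (- X1) <= qminus S)%MS by apply: Ad_qminus; rewrite ?eqmx_opp.
  have hhh : H (h1^-1 * h^-1 * h2)%g.
    by apply: (subMH hS) => //; apply: (subMH hS); exact: hV.
  rewrite (QmQp_mull _ _ hXN) (QmQp_mull _ _ hX1N).
  rewrite (QmQp_mulr _ _ hY) (QmQp_mulr _ _ hY2) -(QmQp_conj _ _ hh2).
  by rewrite -(hf _ (e eta') (e xi') hhh) !mulgA.
(* Both values are now multiples of the value of [f] at the same double coset; dividing by the
   nonzero [omega] values leaves the ratio of [Phi]. *)
rewrite yE xE (omegaM hS _ _ (subMH hS (hV _ hh1) (hV _ hh)) hh2).
rewrite (omegaM hS _ _ (hV _ hh1) (hV _ hh)) !(omegaV hS)//.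
have := omega_neq0 hS kappa lambda hh; have := omega_neq0 hS kappa lambda hh1.
have := omega_neq0 hS kappa lambda hh'.
rewrite (omega_horo hxi heta hd) (omega_horo hxi' heta' hd').
move: (Phi _ _ _ _) (Phi _ _ _ _) (omega _ _ _ h1) => P' P w1 P'0 w10 P0.
by field; rewrite P'0 w10 P0.
Qed.

End Formula.

(** * The domain of the horospherical formula *)

Section OpenSets.
Context {R : realType} {n : nat} (G : lieGroupType R n).

Lemma open_right_translate (A : set G) (g : G) : open A ->
  open [set p : G | A (p * g)%g].
Proof.
move=> oA; have c : continuous (fun p : G => (p * g)%g : G).
  by move=> p; apply: lie_mul_continuous_at => //; exact: cst_continuous.
exact: (open_comp (fun p _ => c p) oA).
Qed.

Lemma dense_right_translate (A : set G) (g : G) : dense A ->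
  dense [set p : G | A (p * g)%g].
Proof.
move=> dA O [p Op] oO.
have [|q [Oq Aq]] :=
  dA [set q : G | O (q * g^-1)%g] _ (open_right_translate (g^-1)%g oO).
  by exists (p * g)%g; rewrite /= mulgK.
by exists (q * g^-1)%g; split => //=; rewrite mulgVK.
Qed.

(** Density passes from the group to the last coordinate: if [p = e X k e Y] is close to [e Y0],
    then [p (e Y0)^-1 = e X k e (Y - Y0)] is close to 1, so [Y - Y0] is small. *)
Lemma bigcell_dense_coord (e : 'rV[R]_n -> G) (Z : 'rV[R]_n) (D : set G)
    (Y0 : 'rV[R]_n) (eps : R) :
  is_lie_exp e -> graded_by G Z ->
  dense [set p : G | D p /\ exists X Y k,
    [/\ grade_one G Z X, Ad k Z = Z, grade_one G (- Z) Y & p = (e X * k * e Y)%g]] ->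
  grade_one G (- Z) Y0 -> 0 < eps ->
  exists X Y k, [/\ grade_one G Z X, Ad k Z = Z, grade_one G (- Z) Y,
    D (e X * k * e Y)%g & `|Y0 - Y| <= eps].
Proof.
move=> he hZ dD hY0 eps0; have hZN := graded_byN hZ.
have [V [V1 oV] VP] : exists2 V : set G, V 1%g /\ open V & forall p, V p ->
    forall (X Y : 'rV[R]_n) (k : G), grade_one G Z X -> Ad k Z = Z ->
    grade_one G (- Z) Y ->
    p = (e X * k * e Y)%g -> `|Y| <= eps.
  pose P : set G := [set p | forall (X Y : 'rV[R]_n) (k : G), grade_one G Z X ->
    Ad k Z = Z -> grade_one G (- Z) Y -> p = (e X * k * e Y)%g -> `|Y| <= eps].
  have nP : nbhs (1%g : G) P := bigcell_coord_small he hZ eps0.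
  exists (interior P); last exact: interior_subset.
  by split => //; exact: open_interior.
have [|p [/= Vp [Dp [X [Y [k [hX hk hY pE]]]]]]] :=
  dD _ _ (open_right_translate (e Y0)^-1%g oV).
  by exists (e Y0); rewrite /= mulgV.
exists X, Y, k; split => //; first by rewrite -pE.
have hYY : grade_one G (- Z) (Y - Y0).
  by apply: (grade_oneD he) => //; exact: (grade_oneN he).
rewrite distrC; apply: (VP _ Vp X _ k hX hk hYY).
rewrite pE (grade_one_expD he hZN)// ?(lie_expN he) ?mulgA//.
exact: (grade_oneN he).
Qed.

End OpenSets.

(** * The domain of the formula in terms of the two open cells *)

Section HoroDomain.
Context {R : realType} {n : nat} {G : lieGroupType R n}.
Context (S : @symmetric_data R n G) (hS : para_hermitian S).
Local Notation e := (sd_exp S).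
Local Notation H := (sd_H S).
Local Notation Z0 := (sd_Z0 S).
Let he : is_lie_exp e := ph_exp hS.
Local Notation Cpm := (prod3 (Qplus S) H (Qminus S)).
Local Notation Cmp := (prod3 (Qminus S) H (Qplus S)).

Lemma CpmP g : Cpm g <-> exists X Y k,
  [/\ grade_one G Z0 X, Ad k Z0 = Z0, grade_one G (- Z0) Y & g = (e X * k * e Y)%g].
Proof.
split.
  move=> [_ [k [_ [[X /= /(qplusP hS) hX <-] /(stabP hS) hk
    [Y /= /(qminusP hS) hY <-] ->]]]].
  by exists X, Y, k.
move=> [X [Y [k [hX hk hY ->]]]]; exists (e X), k, (e Y); split => //.
- by exists X => //=; apply/(qplusP hS).
- exact/(stabP hS).
- by exists Y => //=; apply/(qminusP hS).
Qed.

(** The double sign gives this cell the shape of the other one for the grading [- Z0], so that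
    [bigcell_dense_coord] covers both. *)
Lemma CmpP g : Cmp g <-> exists X Y k,
  [/\ grade_one G (- Z0) X, Ad k (- Z0) = - Z0, grade_one G (- - Z0) Y &
    g = (e X * k * e Y)%g].
Proof.
rewrite opprK; split.
  move=> [_ [k [_ [[X /= /(qminusP hS) hX <-] /(stabNP hS) hk
    [Y /= /(qplusP hS) hY <-] ->]]]].
  by exists X, Y, k.
move=> [X [Y [k [hX hk hY ->]]]]; exists (e X), k, (e Y); split => //.
- by exists X => //=; apply/(qminusP hS).
- exact/(stabNP hS).
- by exists Y => //=; apply/(qplusP hS).
Qed.

(** The cell is stable under [P^+] on the left and [P^-] on the right: factors in H are moved to the
    middle, since [Ad] of H preserves q^+ and q^-. *)
Lemma Cpm_mul X h k Y g : (X <= qplus S)%MS -> H h -> H k -> (Y <= qminus S)%MS ->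
  Cpm g -> Cpm (h * e X * g * e Y * k)%g.
Proof.
move=> hX hh hk hY [_ [c [_ [[x /= hx <-] hc [y /= hy <-] ->]]]].
have hV := subVH hS hk.
exists (e (Ad h (X + x))), (h * c * k)%g, (e (Ad (k^-1)%g (y + Y))); split.
- by exists (Ad h (X + x)) => //=; apply: Ad_qplus => //; exact: addmx_sub.
- by apply: (subMH hS) => //; exact: (subMH hS).
- by exists (Ad (k^-1)%g (y + Y)) => //=; apply: Ad_qminus => //; exact: addmx_sub.
rewrite -!(exp_conj he) (exp_qplusD hS)// (exp_qminusD hS)// invgK.
by rewrite !mulgA mulgK mulgVK.
Qed.

Lemma Cmp_mul X h g : (X <= qminus S)%MS -> H h -> Cmp g -> Cmp (h * e X * g)%g.
Proof.
move=> hX hh [_ [c [_ [[x /= hx <-] hc [y /= hy <-] ->]]]].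
exists (e (Ad h (X + x))), (h * c)%g, (e y); split.
- by exists (Ad h (X + x)) => //=; apply: Ad_qminus => //; exact: addmx_sub.
- exact: (subMH hS).
- by exists y.
by rewrite -(exp_conj he) (exp_qminusD hS)// !mulgA mulgVK.
Qed.

Lemma qminus_act_exists xi g : (exists h xi', qminus_act S xi g h xi') <->
  Cpm (e xi * g)%g.
Proof.
split=> [[h [xi' [hh hxi' [Y hY ->]]]]|].
  by exists (e Y), h, (e xi'); split => //; [exists Y|exists xi'].
move=> [_ [h [_ [[Y hY <-] hh [xi' hxi' <-] E]]]].
by exists h, xi'; split => //; exists Y.
Qed.

Lemma qplus_act_exists eta g : (exists h eta', qplus_act S eta g h eta') <->
  Cmp (e eta * g)%g.
Proof.
split=> [[h [eta' [hh heta' [Y hY ->]]]]|].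
  by exists (e Y), h, (e eta'); split => //; [exists Y|exists eta'].
move=> [_ [h [_ [[Y hY <-] hh [xi' hxi' <-] E]]]].
by exists h, xi'; split => //; exists Y.
Qed.

(** Moving [h] across [e X] exchanges a factorization in [Q^+ Q^- H] for one in [Q^+ H Q^-]. *)
Lemma horo_coord_exists xi eta : (exists x, has_horo_coord S x xi eta) <->
  Cpm (e xi * (e eta)^-1)%g.
Proof.
split=> [[x [X [Y [h [[hX hY hh E] _]]]]]|].
  have hV := subVH hS hh.
  rewrite -(lie_expN he) E; exists (e (- Y)), h, (e (Ad (h^-1)%g X)); split => //.
  - by exists (- Y) => //=; rewrite eqmx_opp.
  - by exists (Ad (h^-1)%g X) => //=; exact: Ad_qminus.
  by rewrite -(exp_conj he) invgK !mulgA mulgK.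
move=> [_ [h [_ [[Y hY <-] hh [X hX <-] E]]]].
exists (Defs.point S (e (- Y) * e xi)%g), (Ad h X), (- Y), h.
split => //; split => //.
- exact: Ad_qminus.
- by rewrite eqmx_opp.
- by rewrite opprK (lie_expN he) E -(exp_conj he) !mulgA mulgVK.
Qed.

(** The quotient of [e xi g2] by [e eta g1] is [e Y h2 (e xi' (e eta')^-1) h1^-1 e (- X)], and the
    outer factors do not affect membership in the cell. A condition on the transformed pair thus
    becomes one on [(xi, eta)]. *)
Lemma horo_coord_act xi eta g1 g2 h1 h2 xi' eta' :
  qminus_act S xi g2 h2 xi' -> qplus_act S eta g1 h1 eta' ->
  Cpm (e xi' * (e eta')^-1)%g <-> Cpm (e xi * g2 * g1^-1 * (e eta)^-1)%g.
Proof.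
move=> [hh2 hxi' [Y hY E2]] [hh1 heta' [X hX E1]]; split=> hC.
  have -> : (e xi * g2 * g1^-1 * (e eta)^-1 =
      h2 * e (Ad (h2^-1)%g Y) * (e xi' * (e eta')^-1) *
      e (Ad (h1^-1)%g (- X)) * h1^-1)%g.
    rewrite -!(exp_conj he) !invgK -[X in X = _]mulgA -invgM E1 E2 !invgM.
    rewrite (lie_expN he).
    by rewrite !mulgA mulgV mul1g mulgK.
  apply: Cpm_mul => //; rewrite ?eqmx_opp//.
  - by apply: Ad_qplus => //; exact: (subVH hS).
  - exact: (subVH hS).
  - by apply: Ad_qminus; rewrite ?eqmx_opp//; exact: (subVH hS).
have -> : (e xi' * (e eta')^-1 =
    h2^-1 * e (- Y) * (e xi * g2 * g1^-1 * (e eta)^-1) * e X * h1)%g.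
  rewrite -[in RHS](mulgA (e xi * g2)%g) -invgM E1 E2 !invgM (lie_expN he) !mulgA.
  by rewrite !mulgVK mulVg mul1g.
by apply: Cpm_mul => //; rewrite ?eqmx_opp//; exact: (subVH hS).
Qed.

Lemma horo_domainE g1 g2 : horo_domain S g1 g2 = qpair S `&`
  [set p | [/\ Cpm (e p.1 * g2)%g, Cmp (e p.2 * g1)%g, Cpm (e p.1 * (e p.2)^-1)%g &
    Cpm (e p.1 * g2 * g1^-1 * (e p.2)^-1)%g]].
Proof.
apply/seteqP; split=> -[xi eta] [hq hd]; split=> //; move: hd.
  move=> [h2 [h1 [xi' [eta' [x [x' [a2 a1 hx hx']]]]]]] /=.
  split.
  - by apply/qminus_act_exists; exists h2, xi'.
  - by apply/qplus_act_exists; exists h1, eta'.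
  - by apply/horo_coord_exists; exists x.
  - by apply/(horo_coord_act a2 a1)/horo_coord_exists; exists x'.
move=> [/= /qminus_act_exists[h2 [xi' a2]] /qplus_act_exists[h1 [eta' a1]]].
move=> /horo_coord_exists[x hx] /(horo_coord_act a2 a1)/horo_coord_exists[x' hx'].
by exists h2, h1, xi', eta', x, x'.
Qed.

Lemma horo_domain_open g1 g2 :
  exists2 O : set ('rV[R]_n * 'rV[R]_n)%type,
        open O & horo_domain S g1 g2 = qpair S `&` O.
Proof.
have [oC _] := ph_bigcell_pm hS; have [oC' _] := ph_bigcell_mp hS.
(* [Em] and [Ep] are continuous on the whole space and agree with [e] on q^- and q^+, so preimages
   of the cells under them yield the open set [O]. *)
pose Em (v : 'rV[R]_n) : G :=
  e (\sum_i (v *m pinvmx (qminus S)) ord0 i *: row i (qminus S)).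
pose Ep (v : 'rV[R]_n) : G :=
  e (\sum_i (v *m pinvmx (qplus S)) ord0 i *: row i (qplus S)).
have cm : continuous Em.
  apply: (exp_grade_one_continuous he (para_gradedN hS)) => v.
  exact: (qminusP hS).
have cp : continuous Ep.
  by apply: (exp_grade_one_continuous he (para_graded hS)) => v; exact: (qplusP hS).
have cm1 : continuous (fun p : 'rV[R]_n * 'rV[R]_n => Em p.1).
  by move=> p; apply: (@continuous_comp _ _ _ fst Em); [exact: cvg_fst|exact: cm].
have cp2 : continuous (fun p : 'rV[R]_n * 'rV[R]_n => Ep p.2).
  by move=> p; apply: (@continuous_comp _ _ _ snd Ep); [exact: cvg_snd|exact: cp].
have cpV : continuous (fun p : 'rV[R]_n * 'rV[R]_n => (Ep p.2)^-1%g : G).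
  move=> p; apply: (@continuous_comp _ _ _ (fun p : 'rV[R]_n * 'rV[R]_n => Ep p.2)
    (fun g : G => g^-1%g : G)); [exact: cp2|exact: lie_inv_continuous].
have cmul (f g : 'rV[R]_n * 'rV[R]_n -> G) : continuous f -> continuous g ->
    continuous (fun p => (f p * g p)%g : G).
  by move=> cf cg p; apply: (@lie_mul_continuous_at _ _ G _ f g p);
    [exact: cf|exact: cg].
have ccst (g : G) : continuous (fun _ : 'rV[R]_n * 'rV[R]_n => g).
  by move=> p; exact: cst_continuous.
have preim (f : 'rV[R]_n * 'rV[R]_n -> G) A :
    continuous f -> open A -> open (f @^-1` A).
  by move=> cf oA; apply: open_comp => // p _; exact: cf.
exists (((fun p => (Em p.1 * g2)%g : G) @^-1` Cpm `&`
    (fun p => (Ep p.2 * g1)%g : G) @^-1` Cmp) `&`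
  ((fun p => (Em p.1 * (Ep p.2)^-1)%g : G) @^-1` Cpm `&`
    (fun p => (Em p.1 * g2 * g1^-1 * (Ep p.2)^-1)%g : G) @^-1` Cpm)).
  have k1 := cmul _ _ cm1 (ccst g2).
  have k4 := cmul _ _ (cmul _ _ k1 (ccst (g1^-1)%g)) cpV.
  apply: openI; apply: openI; apply: preim => //.
    exact: (cmul _ _ cp2 (ccst g1)).
  exact: (cmul _ _ cm1 cpV).
rewrite horo_domainE; apply/seteqP; split=> -[xi eta] [[/= hxi heta]];
  rewrite /= /Em /Ep !row_expansion//.
  by move=> [? ? ? ?].
by move=> [[? ?] [? ?]].
Qed.

Lemma horo_domain_dense g1 g2 : qpair S `<=` closure (horo_domain S g1 g2).
Proof.
have [oC dC] := ph_bigcell_pm hS; have [oC' dC'] := ph_bigcell_mp hS.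
move=> [xi0 eta0] [/= hxi0 heta0] B [[B1 B2] /= [/nbhs_ballP[r1 /= r10 b1]
  /nbhs_ballP[r2 /= r20 b2]] sB].
(* First [eta] is chosen near [eta0], subject to the one condition that does not involve [xi]. *)
have d1 : dense [set p : G | Cmp (p * g1)%g /\ exists X Y k,
    [/\ grade_one G (- Z0) X, Ad k (- Z0) = - Z0, grade_one G (- - Z0) Y &
      p = (e X * k * e Y)%g]].
  have := denseI oC' dC' (dense_right_translate g1 dC').
  by congr dense; apply/seteqP; split=> p [h1 h2]; split => //; exact/CmpP.
have [||X1 [eta [k1 [hX1 hk1 heta D1 n1]]]] :=
  bigcell_dense_coord (Y0 := eta0) (eps := r2 / 2) he (para_gradedN hS) d1.
  by rewrite opprK; apply/(qplusP hS).
  by rewrite divr_gt0.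
rewrite opprK in heta.
(* With [eta] fixed, the other three conditions concern [xi] alone; each holds on a right translate
   of the open dense cell. *)
have d2 : dense [set p : G | (Cpm (p * g2)%g /\ (Cpm (p * (e eta)^-1)%g /\
     Cpm (p * (g2 * g1^-1 * (e eta)^-1))%g)) /\ exists X Y k,
    [/\ grade_one G Z0 X, Ad k Z0 = Z0, grade_one G (- Z0) Y &
      p = (e X * k * e Y)%g]].
  have t g := dense_right_translate g dC.
  have o g := open_right_translate g oC.
  have := denseI oC dC (denseI (o _) (t g2) (denseI (o _) (t (e eta)^-1%g)
    (t (g2 * g1^-1 * (e eta)^-1)%g))).
  by congr dense; apply/seteqP; split=> p [h1 h2]; split => //; exact/CpmP.
have [||X2 [xi [k2 [hX2 hk2 hxi [D2 [D3 D4]] n2]]]] :=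
  bigcell_dense_coord (Y0 := xi0) (eps := r1 / 2) he (para_graded hS) d2.
  by apply/(qminusP hS).
  by rewrite divr_gt0.
exists (xi, eta); split; last first.
  apply: sB; split => /=.
    apply: b1; rewrite -ball_normE /=; apply: le_lt_trans n2 _.
    by rewrite ltr_pdivrMr// ltr_pMr// ltr1n.
  apply: b2; rewrite -ball_normE /=; apply: le_lt_trans n1 _.
  by rewrite ltr_pdivrMr// ltr_pMr// ltr1n.
rewrite horo_domainE; split => /=.
  by split; [apply/(qminusP hS)|apply/(qplusP hS)].
have hX2' : (- X2 <= qplus S)%MS by rewrite eqmx_opp; exact/(qplusP hS).
have hX1' : (- X1 <= qminus S)%MS by rewrite eqmx_opp; exact/(qminusP hS).
have hk2V : H (k2^-1)%g by apply: (subVH hS); exact/(stabP hS).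
have hk1V : H (k1^-1)%g by apply: (subVH hS); exact/(stabNP hS).
(* The approximating element is [e X2 k2 e xi]; its part [e X2 k2] in [P^+] can be removed without
   leaving the cell. *)
have strip g : Cpm (e X2 * k2 * e xi * g)%g -> Cpm (e xi * g)%g.
  move=> /(Cpm_mul hX2' hk2V (sub1H hS) (sub0mx _ _)).
  by rewrite (lie_exp0 he) !mulg1 (lie_expN he) !mulgA mulgVK mulVg mul1g.
split.
- exact: strip.
- have := Cmp_mul hX1' hk1V D1.
  by rewrite (lie_expN he) !mulgA mulgVK mulVg mul1g.
- exact: strip.
- by rewrite -!mulgA; apply: strip; rewrite !mulgA in D4 *.
Qed.

End HoroDomain.

Theorem theorem1 (R : realType) (n : nat) (G : lieGroupType R n)
  (S : @symmetric_data R n G) (hS : para_hermitian S)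
  (kappa r : nat) (hkappa : jordan_genus S kappa) (hr : jordan_rank S r)
  (N : pair_poly S) (hNirr : pair_irreducible N)
  (hNminus : degree_minus N = r) (hNplus : degree_plus N = r)
  (hN : forall (xi eta X Y : 'rV[R]_n) (h : G),
     (xi <= qminus S)%MS -> (eta <= qplus S)%MS ->
     horo_decomp S xi eta X Y h ->
     b_char S h = (pair_eval N xi eta ^+ kappa)^-1)
  (lambda : R[i]) (g1 g2 : G) :
  [/\ exists2 O : set ('rV[R]_n * 'rV[R]_n)%type,
        open O & horo_domain S g1 g2 = qpair S `&` O,
      qpair S `<=` closure (horo_domain S g1 g2) &
      forall f : set G -> R[i], D_space S kappa lambda f ->
      forall (xi eta xi' eta' : 'rV[R]_n) (h2 h1 : G) (x x' : set G),
        (xi <= qminus S)%MS -> (eta <= qplus S)%MS ->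
        qminus_act S xi g2 h2 xi' ->
        qplus_act S eta g1 h1 eta' ->
        has_horo_coord S x xi eta ->
        has_horo_coord S x' xi' eta' ->
        R_rep g1 g2 f x =
        Phi N lambda xi' eta' / Phi N lambda xi eta
        * omega S kappa lambda h2 * omega S kappa lambda (h1^-1)%g * f x'].
Proof.
have [kappa0 _] := hkappa; split.
- exact: horo_domain_open.
- exact: horo_domain_dense.
- by move=> f hf; exact: (R_rep_formula hS kappa0 hN hf).
Qed.
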